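(* Let $\varphi$ be a finite Orlicz function. The Orlicz sequence space $\ell_\varphi$ has the Radon-Nikodým property if and only if $\varphi$ satisfies the $\Delta_2^0$ condition.
   Context: All spaces are real. An Orlicz function is a convex, left-continuous function $\varphi:[0,\infty)\to[0,\infty]$ with $\varphi(0)=0$, not identically zero and not identically infinite on $(0,\infty)$; it is finite if it does not take the value $\infty$. $\varphi$ satisfies $\Delta_2^0$ if there are $K>2$ and $u_0$ with $0<\varphi(u_0)<\infty$ and $\varphi(2u)\le K\varphi(u)$ for all $0\le u\le u_0$. $\ell_\varphi$ is the space of real sequences $x=\{x(n)\}$ such that $I_\varphi(\lambda x)=\sum_{n}\varphi(\lambda|x(n)|)<\infty$ for some $\lambda>0$, with the Luxemburg norm $\|x\|_\varphi=\inf\{\epsilon>0:I_\varphi(x/\epsilon)\le1\}$. The Radon-Nikodým property is the classical one for Banach spaces; equivalently, every nonempty closed bounded convex subset of the space has slices of arbitrarily small diameter. *)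

(* Defs.v *)
From HB Require Import structures.
From mathcomp Require Import all_boot all_order all_algebra.
From mathcomp Require Import all_classical all_reals all_analysis.
From mathcomp Require Import ring lra.

Set Implicit Arguments.
Unset Strict Implicit.
Unset Printing Implicit Defensive.

Import Order.TTheory GRing.Theory Num.Theory.
Import numFieldNormedType.Exports.

Local Open Scope classical_set_scope.
Local Open Scope ring_scope.

(** * Orlicz functions *)

(* A function [0, oo) -> [0, oo] is encoded as a function R -> \bar R of which
   only the restriction to [0, oo) is constrained and used. *)
Record is_orlicz (R : realType) (phi : R -> \bar R) : Prop := IsOrlicz {
  orlicz_ge0 : forall u : R, 0 <= u -> (0 <= phi u)%E ;
  orlicz0 : phi 0 = 0%E ;
  orlicz_convex : forall t u v : R, 0 <= t <= 1 -> 0 <= u -> 0 <= v ->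
    (phi (t * u + (1 - t) * v)%R <= t%:E * phi u + (1 - t)%:E * phi v)%E ;
  orlicz_left_cont : forall u : R, 0 < u -> phi t @[t --> u^'-] --> phi u ;
  orlicz_neq0 : exists2 u : R, 0 < u & phi u <> 0%E ;
  orlicz_neqy : exists2 u : R, 0 < u & phi u <> +oo%E }.

Record orlicz (R : realType) := Orlicz {
  orlicz_fun :> R -> \bar R ;
  orliczP : is_orlicz orlicz_fun }.

Definition finite_orlicz (R : realType) (phi : orlicz R) : Prop :=
  forall u : R, 0 <= u -> (phi u < +oo)%E.

Definition Delta2_0 (R : realType) (phi : orlicz R) : Prop :=
  exists K u0 : R, [/\ 2 < K, 0 <= u0, (0 < phi u0 < +oo)%E &
    forall u : R, 0 <= u <= u0 -> (phi (2 * u)%R <= K%:E * phi u)%E].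

(** * Orlicz sequence spaces *)

Definition modular (R : realType) (phi : orlicz R) (x : nat -> R) : \bar R :=
  (\sum_(0 <= n <oo) phi `|x n|%R)%E.

Definition ell_pred (R : realType) (phi : orlicz R) : {pred (nat -> R^o)} :=
  fun x => `[< exists2 l : R, 0 < l &
                 (modular phi (fun n => (l * x n)%R) < +oo)%E >].

Record ell (R : realType) (phi : orlicz R) := Ell {
  ell_val :> nat -> R^o ;
  ell_valP : ell_val \in ell_pred phi }.

Definition luxemburg (R : realType) (phi : orlicz R) (x : nat -> R) : R :=
  inf [set e : R | 0 < e /\ (modular phi (fun n => (x n / e)%R) <= 1)%E].

Section orlicz_theory.
Context (R : realType) (phi : orlicz R).
Implicit Types (x y z : nat -> R).

Lemma orlicz_scale t u : 0 <= t <= 1 -> 0 <= u ->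
  (phi (t * u)%R <= t%:E * phi u)%E.
Proof.
move=> t01 u0; have := orlicz_convex (orliczP phi) t01 u0 (lexx 0).
by rewrite mulr0 addr0 (orlicz0 (orliczP phi)) mule0 adde0.
Qed.

Lemma orlicz_mono u v : 0 <= u -> u <= v -> (phi u <= phi v)%E.
Proof.
move=> u0 uv; have v0 := le_trans u0 uv.
have [v0'|vn0] := eqVneq v 0.
  by have -> : u = v by apply/le_anti; rewrite uv v0' u0.
have vgt0 : 0 < v by rewrite lt_def vn0.
have -> : u = (u / v) * v by rewrite divfK.
have uv1 : u / v <= 1 by rewrite ler_pdivrMr// mul1r.
apply: (le_trans (orlicz_scale _ v0)); first by rewrite divr_ge0.
by rewrite gee_pMl// ?lee_fin// (orlicz_ge0 (orliczP phi)).
Qed.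

Lemma modular_ge0 x : (0 <= modular phi x)%E.
Proof. by apply: nneseries_ge0 => n _ _; exact: (orlicz_ge0 (orliczP phi)). Qed.

Lemma modular_mono x y : (forall n, `|x n| <= `|y n|) ->
  (modular phi x <= modular phi y)%E.
Proof.
move=> xy; apply: lee_nneseries => n *; last exact: orlicz_mono.
exact: (orlicz_ge0 (orliczP phi)).
Qed.

Lemma modular_convex t x y z : 0 <= t <= 1 ->
  (forall n, `|z n| <= t * `|x n| + (1 - t) * `|y n|) ->
  (modular phi z <= t%:E * modular phi x + (1 - t)%:E * modular phi y)%E.
Proof.
move=> t01 zxy; have /andP[t0 t1] := t01.
have p0 (w : nat -> R) n : (0 <= phi `|w n|%R)%E.
  exact: (orlicz_ge0 (orliczP phi)).
rewrite /modular -!nneseriesZl// -nneseriesD//; last 2 first.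
- by move=> n _ _; rewrite mule_ge0.
- by move=> n _ _; rewrite mule_ge0// lee_fin subr_ge0.
apply: lee_nneseries => [n _ _//|n _].
apply: (le_trans (orlicz_mono _ (zxy n))) => //.
exact: (orlicz_convex (orliczP phi)).
Qed.

Lemma modular0 : modular phi (fun=> 0) = 0%E.
Proof.
by rewrite /modular eseries0// => n _ _; rewrite normr0 (orlicz0 (orliczP phi)).
Qed.

Lemma modular_scale t x : 0 <= t <= 1 ->
  (modular phi (fun n => (t * x n)%R) <= t%:E * modular phi x)%E.
Proof.
move=> t01; have /andP[t0 _] := t01.
have := @modular_convex t x (fun=> 0) (fun n => t * x n) t01.
rewrite modular0 mule0 adde0; apply=> n.
by rewrite normr0 mulr0 addr0 normrM ger0_norm.
Qed.

Lemma ell_submod_closed : submod_closed (ell_pred phi).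
Proof.
split.
  apply/asboolP; exists 1 => //.
  by under [X in modular _ X]eq_fun do rewrite mulr0; rewrite modular0 ltry.
move=> a x y /asboolP[l l0 Il] /asboolP[m m0 Im]; apply/asboolP.
have a1 : 0 < `|a| + 1 by rewrite ltr_wpDl.
pose k := Num.min (l / (`|a| + 1)) m.
have k0 : 0 < k by rewrite lt_min divr_gt0.
exists (2^-1 * k); first by rewrite mulr_gt0// invr_gt0.
have h : 0 <= (2^-1 : R) <= 1 by lra.
apply: (le_lt_trans (@modular_convex 2^-1 (fun n => l * x n)
  (fun n => m * y n) _ h _)).
  move=> n; rewrite [1 - _](_ : _ = 2^-1); last by lra.
  rewrite -mulrDr -mulrA normrM ger0_norm// ler_pM2l// normrM (gtr0_norm k0).
  rewrite !normrM (gtr0_norm l0) (gtr0_norm m0).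
  apply: (@le_trans _ _ (k * (`|a * x n| + `|y n|))).
    by rewrite ler_pM2l//; exact: ler_normD.
  rewrite mulrDr lerD//; last by rewrite ler_wpM2r// ge_min lexx orbT.
  rewrite normrM mulrA ler_wpM2r//.
  apply: (@le_trans _ _ (l / (`|a| + 1) * `|a|)).
    by rewrite ler_wpM2r// ge_min lexx.
  by rewrite -mulrA ler_piMr ?(ltW l0)// mulrC ler_pdivrMr// mul1r lerDl.
apply: lte_add_pinfty; rewrite lte_mul_pinfty// lee_fin; lra.
Qed.

HB.instance Definition _ := [isSub for @ell_val R phi].
HB.instance Definition _ := [Choice of ell phi by <:].
HB.instance Definition _ := GRing.isSubmodClosed.Build _ _ (ell_pred phi)
  ell_submod_closed.
HB.instance Definition _ := [SubChoice_isSubLmodule of ell phi by <:].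

Lemma luxemburg_lbound x e :
  0 < e -> (modular phi (fun n => (x n / e)%R) <= 1)%E -> luxemburg phi x <= e.
Proof.
move=> e0 Ie; apply: ge_inf => //; exists 0 => r [r0 _]; exact: ltW.
Qed.

Lemma luxemburg_nonempty x : x \in ell_pred phi ->
  [set e : R | 0 < e /\ (modular phi (fun n => (x n / e)%R) <= 1)%E] !=set0.
Proof.
move=> /asboolP[l l0 Il].
set M := modular _ _ in Il.
have M0 : (0 <= M)%E := modular_ge0 _.
have Mfin : M \is a fin_num by rewrite ge0_fin_numE.
have f0 : 0 <= fine M by rewrite fine_ge0.
have f1 : 0 < 1 + fine M by rewrite ltr_pwDl.
exists (l^-1 * (1 + fine M)); split; first by rewrite mulr_gt0// invr_gt0.
have -> : (fun n => x n / (l^-1 * (1 + fine M))) =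
          (fun n => (1 + fine M)^-1 * (l * x n)).
  by apply/funext => n; rewrite invfM invrK; ring.
apply: (le_trans (@modular_scale _ _ _)).
  by rewrite invr_ge0 ltW//= invf_le1// lerDl.
rewrite -/M -(fineK Mfin) -EFinM lee_fin mulrC ler_pdivrMr// mul1r.
by rewrite lerDr.
Qed.

Lemma luxemburg_ge0 x : x \in ell_pred phi -> 0 <= luxemburg phi x.
Proof.
by move=> xP; apply: lb_le_inf; [exact: luxemburg_nonempty|move=> e [/ltW]].
Qed.

Lemma luxemburgD (x y : ell phi) :
  luxemburg phi (x + y : ell phi) <= luxemburg phi x + luxemburg phi y.
Proof.
rewrite -lerBlDr; apply: lb_le_inf; first exact: luxemburg_nonempty (ell_valP x).
move=> e [e0 Ie]; rewrite lerBlDr -lerBlDl.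
apply: lb_le_inf; first exact: luxemburg_nonempty (ell_valP y).
move=> f [f0 If]; rewrite lerBlDl.
have ef0 : 0 < e + f by rewrite addr_gt0.
apply: luxemburg_lbound => //.
have t01 : 0 <= e / (e + f) <= 1.
  by rewrite divr_ge0 ?(ltW e0) ?(ltW ef0)//= ler_pdivrMr// mul1r lerDl ltW.
have E1 : 1 - e / (e + f) = f / (e + f) by field; rewrite gt_eqF.
apply: (le_trans (@modular_convex (e / (e + f)) (fun n => x n / e)
  (fun n => y n / f) _ t01 _)).
  move=> n; rewrite E1.
  rewrite [(x + y : ell phi) n](_ : _ = x n + y n)//.
  rewrite !normrM !normfV !(gtr0_norm ef0) (gtr0_norm e0) (gtr0_norm f0).
  rewrite [leRHS](_ : _ = (`|x n| + `|y n|) / (e + f)).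
    by rewrite ler_wpM2r ?ler_normD// invr_ge0 ltW.
  by field; rewrite !gt_eqF.
rewrite E1; apply: (@le_trans _ _ ((e / (e + f))%:E * 1 + (f / (e + f))%:E * 1)%E).
  by rewrite leeD// lee_wpmul2l// lee_fin divr_ge0// ltW.
by rewrite !mule1 -EFinD lee_fin -mulrDl divff ?gt_eqF.
Qed.

Lemma luxemburgZ_le a (x : ell phi) :
  luxemburg phi (a *: x : ell phi) <= `|a| * luxemburg phi x.
Proof.
have [->|a0] := eqVneq a 0.
  rewrite normr0 mul0r scale0r; apply/ler_addgt0Pr => e e0; rewrite add0r.
  apply: luxemburg_lbound => //.
  rewrite [fun n => _](_ : _ = fun=> 0) ?modular0 ?lee01//.
  by apply/funext => n; rewrite -[RHS](mul0r e^-1).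
have na0 : 0 < `|a| by rewrite normr_gt0.
rewrite mulrC -ler_pdivrMr//.
apply: lb_le_inf; first exact: luxemburg_nonempty (ell_valP x).
move=> e [e0 Ie]; rewrite ler_pdivrMr//.
apply: luxemburg_lbound; first exact: mulr_gt0.
apply: le_trans Ie; apply: modular_mono => n.
rewrite [(a *: x : ell phi) n](_ : _ = a * x n)//.
rewrite !normrM !normfV normrM normr_id (gtr0_norm e0).
rewrite [leLHS](_ : _ = `|x n| / e)//; field.
by rewrite !gt_eqF.
Qed.

Lemma luxemburgZ a (x : ell phi) :
  luxemburg phi (a *: x : ell phi) = `|a| * luxemburg phi x.
Proof.
apply/le_anti; rewrite luxemburgZ_le/=.
have [->|a0] := eqVneq a 0.
  by rewrite normr0 mul0r; exact: luxemburg_ge0 (ell_valP (0 *: x : ell phi)).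
rewrite -{1}(scalerK a0 x) mulrC -ler_pdivlMr ?normr_gt0//.
by rewrite mulrC -normfV luxemburgZ_le.
Qed.

Lemma luxemburg_eq0 (x : ell phi) : luxemburg phi x = 0 -> x = 0.
Proof.
move=> x0; apply/val_inj/funext => n /=.
apply/eqP/negPn/negP => xn0.
have nx0 : 0 < `|x n| by rewrite normr_gt0.
have H d : 0 < d -> (phi (`|x n| / d)%R <= 1)%E.
  move=> d0.
  have hi : has_inf [set e : R | 0 < e /\
      (modular phi (fun n => (x n / e)%R) <= 1)%E].
    split; first exact: luxemburg_nonempty (ell_valP x).
    by exists 0 => r [/ltW].
  have [e [e0 Ie]] := inf_adherent d0 hi.
  rewrite -/(luxemburg phi x) x0 add0r => ed.
  apply: le_trans Ie.
  apply: (@le_trans _ _ (phi `|x n / e|%R)).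
    apply: orlicz_mono; first by rewrite divr_ge0// ltW.
    rewrite normrM normfV (gtr0_norm e0) ler_pM2l//.
    by rewrite lef_pV2 ?posrE// ltW.
  have p0 m : (0 <= phi `|x m / e|%R)%E by exact: (orlicz_ge0 (orliczP phi)).
  apply: le_trans (nneseries_lim_ge n.+1 _); last by move=> m _ _.
  by rewrite big_nat_recr//= leeDr// sume_ge0.
have [v v0 /eqP pv0] := orlicz_neq0 (orliczP phi).
have pv_ge0 : (0 <= phi v)%E by apply: (orlicz_ge0 (orliczP phi)); exact: ltW.
have Hk k : 0 < k -> (phi (k * v)%R <= 1)%E.
  move=> k0; have kv : 0 < k * v by rewrite mulr_gt0.
  have := H (`|x n| / (k * v)); rewrite divr_gt0// => /(_ isT).
  by rewrite invf_div mulrC divfK// gt_eqF.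
have pv1 : (phi v <= 1)%E by have := Hk 1 ltr01; rewrite mul1r.
have fpv : phi v \is a fin_num.
  by rewrite ge0_fin_numE// (le_lt_trans pv1)// ltry.
have r0 : 0 < fine (phi v).
  by rewrite lt_def fine_ge0// andbT fine_eq0.
have r1 : fine (phi v) <= 1 by rewrite -lee_fin fineK.
set r := fine (phi v) in r0 r1.
have k0 : 0 < 2 / r by rewrite divr_gt0.
have t01 : 0 <= r / 2 <= 1 by lra.
have kv0 : 0 <= 2 / r * v by rewrite mulr_ge0// ltW.
have := orlicz_scale t01 kv0.
rewrite (_ : r / 2 * (2 / r * v) = v); last by field; rewrite gt_eqF.
move=> pvle.
have : (phi v <= (r / 2)%:E * 1)%E.
  apply: (le_trans pvle); rewrite lee_wpmul2l ?Hk// lee_fin; lra.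
by rewrite mule1 -(fineK fpv) lee_fin -/r; lra.
Qed.

HB.instance Definition _ := Lmodule_isNormed.Build R (ell phi)
  luxemburgD luxemburgZ luxemburg_eq0.

End orlicz_theory.

Lemma ell_normE (R : realType) (phi : orlicz R) (x : ell phi) :
  `|x| = luxemburg phi x.
Proof. by []. Qed.

(** * The Bochner integral *)

Definition is_simple d (T : measurableType d) (V : Type) (s : T -> V) : Prop :=
  finite_set (range s) /\ forall v, measurable (s @^-1` [set v]).

Definition simple_integral d (T : measurableType d) (R : realType)
    (V : normedModType R) (mu : {finite_measure set T -> \bar R})
    (E : set T) (s : T -> V) : V :=
  \sum_(v \in range s) fine (mu (E `&` s @^-1` [set v])) *: v.

(* The convergence is required at every point rather than almost everywhere: a
   function for which it holds almost everywhere agrees, off a measurable null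
   set, with one that is strongly measurable in the present sense. *)
Definition strongly_measurable d (T : measurableType d) (R : realType)
    (V : normedModType R) (g : T -> V) : Prop :=
  exists2 s : nat -> T -> V, (forall n, is_simple (s n)) &
    forall x, s n x @[n --> \oo] --> g x.

Definition bochner_approx d (T : measurableType d) (R : realType)
    (V : normedModType R) (mu : {finite_measure set T -> \bar R})
    (g : T -> V) (s : nat -> T -> V) : Prop :=
  (forall n, is_simple (s n)) /\
  (\int[mu]_x (`|g x - s n x|%:E))%E @[n --> \oo] --> 0%E.

Definition bochner_integrable d (T : measurableType d) (R : realType)
    (V : normedModType R) (mu : {finite_measure set T -> \bar R})
    (g : T -> V) : Prop :=
  strongly_measurable g /\ exists s, bochner_approx mu g s.

(* For a Bochner integrable g: v is the Bochner integral of g over E. *)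
Definition is_bochner_integral d (T : measurableType d) (R : realType)
    (V : normedModType R) (mu : {finite_measure set T -> \bar R})
    (E : set T) (g : T -> V) (v : V) : Prop :=
  exists2 s, bochner_approx mu g s &
    simple_integral mu E (s n) @[n --> \oo] --> v.

(** * Vector measures and the Radon-Nikodym property *)

Definition vector_measure d (T : measurableType d) (R : realType)
    (V : normedModType R) (G : set T -> V) : Prop :=
  forall F : nat -> set T, (forall i, measurable (F i)) -> trivIset setT F ->
    \sum_(0 <= i < n) G (F i) @[n --> \oo] --> G (\bigcup_i F i).

Definition vector_variation d (T : measurableType d) (R : realType)
    (V : normedModType R) (G : set T -> V) (E : set T) : \bar R :=
  ereal_sup [set r | exists (n : nat) (F : nat -> set T),
    [/\ forall i, (i < n)%N -> measurable (F i), trivIset `I_n F,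
        \bigcup_(i in `I_n) F i = E & r = (\sum_(i < n) `|G (F i)|)%:E]].

Definition mu_continuous d (T : measurableType d) (R : realType)
    (V : normedModType R) (mu : {finite_measure set T -> \bar R})
    (G : set T -> V) : Prop :=
  forall e : R, 0 < e -> exists2 k : R, 0 < k &
    forall E, measurable E -> (mu E < k%:E)%E -> `|G E| < e.

(* Each vector measure of bounded variation that is absolutely continuous with
   respect to a finite measure mu has a Bochner integrable density. *)
Definition radon_nikodym_property (R : realType) (V : normedModType R) : Prop :=
  forall (d : measure_display) (T : measurableType d)
      (mu : {finite_measure set T -> \bar R}) (G : set T -> V),
    vector_measure G -> (vector_variation G setT < +oo)%E ->
    mu_continuous mu G ->
    exists2 g : T -> V, bochner_integrable mu g &
      forall E, measurable E -> is_bochner_integral mu E g (G E).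

(* Main.v *)
From HB Require Import structures.
Require Import Defs.
From mathcomp Require Import all_boot all_order all_algebra.
From mathcomp Require Import all_classical all_reals all_analysis.
From mathcomp Require Import finmap measurable_realfun ring lra.

Set Implicit Arguments.
Unset Strict Implicit.
Unset Printing Implicit Defensive.

Import Order.TTheory GRing.Theory Num.Theory.
Import numFieldNormedType.Exports.

Local Open Scope classical_set_scope.
Local Open Scope ring_scope.

(* Assume Delta2_0.  The coordinates of a vector measure G have scalar densities
   f_n.  Let h_N be built from simple approximations s of the first N densities
   with s^2 <= s f_n.  On a level set A = {h_N = v} this gives
   |v_n| mu(A) <= |G(A)_n| for all n, hence ||v|| mu(A) <= ||G(A)||, so that the
   integral of ||h_N|| is at most the variation of G.  By monotone convergence
   and the Fatou property of the norm, the sequence (f_n(t))_n is in the space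
   for almost every t.  Under Delta2_0 the norm is order continuous, which makes
   h_N converge to this density, pointwise and, by domination, in L^1.

   If Delta2_0 fails, there are levels u_k and lengths m_k with
   m_k phi(u_k) <= 2^-(k+1) and m_k phi(2 u_k) >= 1.  Consecutive blocks of m_k
   coordinates equal to u_k span a copy of l^oo, in which
   E |-> (|E `&` ]-oo, q_k]|)_k, for (q_k) enumerating the nonnegative rationals,
   is a vector measure on [0, 1], dominated by Lebesgue measure, without a
   density. *)

(** * The modular and the Luxemburg norm *)

Section orlicz_lemmas.
Context (R : realType) (phi : orlicz R).

Lemma orlicz_fun_ge0 (u : R) : 0 <= u -> (0 <= phi u)%E.
Proof. exact: (orlicz_ge0 (orliczP phi)). Qed.

Lemma orlicz_norm_ge0 (u : R) : (0 <= phi `|u|%R)%E.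
Proof. exact: orlicz_fun_ge0. Qed.

Lemma orlicz_scale_ge (k u : R) : 1 <= k -> 0 <= u ->
  (k%:E * phi u <= phi (k * u)%R)%E.
Proof.
move=> k1 u0; have k0 : 0 < k by rewrite (lt_le_trans ltr01).
rewrite -lee_pdivlMl//.
have {1}-> : u = k^-1 * (k * u) by rewrite mulrA mulVf ?gt_eqF// mul1r.
apply: orlicz_scale; last by rewrite mulr_ge0// ltW.
by rewrite invr_ge0 (ltW k0)/= invf_le1.
Qed.

Lemma orlicz_gt1 : exists2 v : R, 0 < v & (1 < phi v)%E.
Proof.
have [u u0 /eqP pu0] := orlicz_neq0 (orliczP phi).
have pu : (0 < phi u)%E by rewrite lt0e pu0 orlicz_fun_ge0// ltW.
have [puy|puy] := eqVneq (phi u) +oo%E; first by exists u; rewrite ?puy ?ltry.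
have pf : phi u \is a fin_num by rewrite ge0_fin_numE ?ltey// ltW.
move: pu; rewrite -(fineK pf) lte_fin => r0.
(* By convexity and phi(0) = 0, phi grows at least linearly along multiples k >= 1 of u; this factor
   brings it to at least phi(u) + 2. *)
have k1 : 1 <= 1 + 2 / fine (phi u) by rewrite lerDl divr_ge0// ltW.
exists ((1 + 2 / fine (phi u)) * u).
  by rewrite mulr_gt0// (lt_le_trans ltr01).
apply: lt_le_trans (orlicz_scale_ge k1 (ltW u0)).
by rewrite -{2}(fineK pf) -EFinM lte_fin mulrDl divfK ?gt_eqF//; lra.
Qed.

Lemma modular_le (x : nat -> R) c :
  (forall m, (\sum_(0 <= n < m) phi `|x n|%R <= c)%E) -> (modular phi x <= c)%E.
Proof.
move=> xc; apply: lime_le; last exact: nearW.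
by apply: is_cvg_nneseries => n _ _; exact: orlicz_norm_ge0.
Qed.

Lemma modular_ge (x : nat -> R) m :
  (\sum_(0 <= n < m) phi `|x n|%R <= modular phi x)%E.
Proof. by apply: nneseries_lim_ge => n _ _; exact: orlicz_norm_ge0. Qed.

Lemma luxemburg_lt_modular (x : nat -> R) e : x \in ell_pred phi ->
  luxemburg phi x < e -> (modular phi (fun n => (x n / e)%R) <= 1)%E.
Proof.
move=> xP xe.
have [r [r0 Ir] re] := inf_lt (luxemburg_nonempty xP) xe.
have e0 : 0 < e := lt_trans r0 re.
apply: le_trans Ir; apply: modular_mono => n.
by rewrite !normrM ler_wpM2l// !normfV !gtr0_norm// lef_pV2 ?posrE// ltW.
Qed.

Lemma luxemburg_le (x : nat -> R) r :
  (forall e, r < e -> luxemburg phi x <= e) -> luxemburg phi x <= r.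
Proof.
by move=> h; apply/ler_addgt0Pr => e e0; apply: h; rewrite ltrDl.
Qed.

Lemma ell_predP (x : nat -> R) e : 0 < e ->
  (modular phi (fun n => (x n / e)%R) < +oo)%E -> x \in ell_pred phi.
Proof.
move=> e0 Ie; apply/asboolP; exists e^-1; first by rewrite invr_gt0.
by under [X in modular _ X]eq_fun do rewrite mulrC.
Qed.

Lemma modular_luxemburg (x y : nat -> R) r : (modular phi x <= 1)%E ->
  0 <= r -> (forall n, `|y n| <= r * `|x n|) ->
  y \in ell_pred phi /\ luxemburg phi y <= r.
Proof.
move=> Ix r0 yx.
have h e : r < e -> (modular phi (fun n => (y n / e)%R) <= 1)%E.
  move=> re; have e0 : 0 < e := le_lt_trans r0 re.
  apply: le_trans Ix; apply: modular_mono => n.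
  rewrite normrM normfV (gtr0_norm e0) ler_pdivrMr//.
  by rewrite (le_trans (yx n))// mulrC ler_wpM2l// ltW.
split; first by apply: (@ell_predP _ (r + 1)); rewrite ?ltr_wpDl//
  (le_lt_trans (h _ _))// ?ltry// ltrDl.
by apply: luxemburg_le => e re; apply: luxemburg_lbound (h _ re);
  exact: le_lt_trans re.
Qed.

Lemma ell_pred_le (x y : nat -> R) : (forall n, `|y n| <= `|x n|) ->
  x \in ell_pred phi -> y \in ell_pred phi.
Proof.
move=> yx /asboolP[l l0 Il]; apply/asboolP; exists l => //.
apply: le_lt_trans Il; apply: modular_mono => n.
by rewrite !normrM ler_wpM2l.
Qed.

Lemma luxemburg_mono (x y : nat -> R) : (forall n, `|y n| <= `|x n|) ->
  x \in ell_pred phi -> luxemburg phi y <= luxemburg phi x.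
Proof.
move=> yx xP; apply: luxemburg_le => e xe.
have e0 : 0 < e := le_lt_trans (luxemburg_ge0 xP) xe.
apply: luxemburg_lbound => //; apply: le_trans (luxemburg_lt_modular xP xe).
by apply: modular_mono => n; rewrite !normrM ler_wpM2r.
Qed.

(** If phi(v) > 1, an entry with |x_n| / e > v would alone push the modular of x / e above 1. Hence
    v serves as the constant, and coordinates are continuous. *)
Lemma coord_bound : exists2 C : R, 0 < C & forall (x : ell phi) n,
  `|x n| <= C * `|x|.
Proof.
have [v v0 pv] := orlicz_gt1; exists v => // x n; rewrite ell_normE.
rewrite mulrC -ler_pdivrMr//; apply: lb_le_inf.
  exact: luxemburg_nonempty (ell_valP x).
move=> e [e0 Ie]; rewrite ler_pdivrMr// leNgt; apply/negP => xn.
have : (phi v <= 1)%E.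
  apply: le_trans Ie; apply: le_trans (modular_ge _ n.+1).
  rewrite big_nat_recr//=; apply: (@le_trans _ _ (phi `|x n / e|%R)).
    apply: orlicz_mono; first exact: ltW.
    by rewrite normrM normfV (gtr0_norm e0) ler_pdivlMr// mulrC ltW.
  by rewrite leeDr// sume_ge0// => *; exact: orlicz_norm_ge0.
by rewrite leNgt pv.
Qed.

Lemma luxemburg_fatou (y : nat -> nat -> R) (x : nat -> R) r :
  (forall m, y m \in ell_pred phi) -> (forall n, y m n @[m --> \oo] --> x n) ->
  0 <= r -> (\forall m \near \oo, luxemburg phi (y m) <= r) ->
  x \in ell_pred phi /\ luxemburg phi x <= r.
Proof.
move=> yP yx r0 yr.
have h e : r < e -> (modular phi (fun n => (x n / e)%R) <= 1)%E.
  move=> re; have e0 : 0 < e := le_lt_trans r0 re.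
  (* The gap between s and e absorbs the error of coordinatewise convergence: |x_n| s / e < |x_n|
     where x_n <> 0, so on finitely many coordinates |x_n| / e is eventually at most |y_m n| / s,
     and phi is compared by monotonicity. *)
  have [s [rs se]] : exists s, r < s /\ s < e by exists ((r + e) / 2); lra.
  have s0 : 0 < s := le_lt_trans r0 rs.
  apply: modular_le => k.
  have : \forall m \near \oo, forall n, (n < k)%N -> `|x n / e| <= `|y m n / s|.
    elim: k => [|k ih]; first by apply: nearW.
    have kk : \forall m \near \oo, `|x k / e| <= `|y m k / s|.
      have [xk0|xk0] := eqVneq (x k) 0.
        by apply: nearW => m; rewrite xk0 mul0r normr0.
      have : `|y m k| @[m --> \oo] --> `|x k| by exact: cvg_norm (yx k).
      move/cvgr_ge => /(_ (`|x k| / e * s)) yk.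
      have {yk}/yk : `|x k| / e * s < `|x k|.
        rewrite -mulrA gtr_pMr ?normr_gt0// mulrC ltr_pdivrMr//.
        by rewrite mul1r.
      apply: filterS => m; rewrite !normrM !normfV (gtr0_norm e0) (gtr0_norm s0).
      by rewrite ler_pdivlMr.
    near=> m => n; rewrite ltnS leq_eqVlt => /orP[/eqP->|nk].
      by near: m.
    by move: n nk; near: m.
  move=> /(filterI yr)/filter_ex[m [ym hm]].
  apply: le_trans (luxemburg_lt_modular (yP m) (le_lt_trans ym rs)).
  apply: le_trans (modular_ge _ k).
  rewrite !big_nat; apply: lee_sum => n /= nk.
  by apply: orlicz_mono => //; exact: hm.
split; first by apply: (@ell_predP _ (r + 1)); rewrite ?ltr_wpDl//
  (le_lt_trans (h _ _))// ?ltry// ltrDl.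
by apply: luxemburg_le => e re; apply: luxemburg_lbound (h _ re);
  exact: le_lt_trans re.
Unshelve. all: by end_near. Qed.

End orlicz_lemmas.

Lemma cvge_near_lt (R : realType) (u : nat -> \bar R) (l c : \bar R) :
  u n @[n --> \oo] --> l -> (l < c)%E -> \forall n \near \oo, (u n < c)%E.
Proof. by move=> ul lc; exact: (ul _ (open_ereal_lt' lc)). Qed.

(** * Order continuity of the norm under Delta2 *)

Section delta2.
Context (R : realType) (phi : orlicz R).
Hypotheses (phi_finite : finite_orlicz phi) (D2 : Delta2_0 phi).

(** A tail of the modular below phi(u0) forces its entries below u0, where the Delta2 inequality
    applies; the finitely many earlier terms are finite because phi is. *)
Lemma Delta2_modular2 (x : nat -> R) : (modular phi x < +oo)%E ->
  (modular phi (fun n => (2 * x n)%R) < +oo)%E.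
Proof.
have [K [u0 [K2 u0_ge0 /andP[pu0 _] D2u0]]] := D2.
move=> Ix.
have := nneseries_tail_cvg Ix (fun k _ => orlicz_norm_ge0 phi (x k)).
move=> /cvge_near_lt/(_ pu0)[N _ tailN].
have xN n : (N <= n)%N -> `|x n| <= u0.
  move=> Nn; rewrite leNgt; apply/negP => u0x.
  have /= := tailN n Nn; apply/negP; rewrite -leNgt.
  rewrite (nneseries_split _ 1); last by move=> *; exact: orlicz_norm_ge0.
  rewrite addn1 big_nat1 -[leLHS]adde0 leeD ?orlicz_mono ?(ltW u0x)//.
  by apply: nneseries_ge0 => *; exact: orlicz_norm_ge0.
rewrite /modular (nneseries_split 0 N); last by move=> *; exact: orlicz_norm_ge0.
rewrite add0n; apply: lte_add_pinfty.
  by rewrite lte_sum_pinfty// => n _; exact: phi_finite.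
apply: (@le_lt_trans _ _ (K%:E * modular phi x)%E); last first.
  by rewrite lte_mul_pinfty// lee_fin; lra.
rewrite /modular [in leRHS](nneseries_split 0 N); last first.
  by move=> *; exact: orlicz_norm_ge0.
rewrite add0n ge0_muleDr; last 2 first.
- by apply: sume_ge0 => *; exact: orlicz_norm_ge0.
- by apply: nneseries_ge0 => *; exact: orlicz_norm_ge0.
rewrite -[leLHS]add0e leeD//.
  rewrite mule_ge0 ?lee_fin//; first lra.
  by apply: sume_ge0 => *; exact: orlicz_norm_ge0.
rewrite -nneseriesZl; last by move=> *; exact: orlicz_norm_ge0.
rewrite eseries_cond [leRHS]eseries_cond.
apply: lee_nneseries => [n _ _|n]; first exact: orlicz_norm_ge0.
move=> /= Nn; rewrite normrM ger0_norm//; apply: D2u0.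
by rewrite normr_ge0 xN.
Qed.

Lemma Delta2_modular (x : nat -> R) e : x \in ell_pred phi -> 0 < e ->
  (modular phi (fun n => (x n / e)%R) < +oo)%E.
Proof.
move=> /asboolP[l l0 Il] e0.
have h p : (modular phi (fun n => (2 ^+ p * (l * x n))%R) < +oo)%E.
  elim: p => [|p ih].
    by under [X in modular _ X]eq_fun do rewrite expr0 mul1r.
  under [X in modular _ X]eq_fun do rewrite exprS -mulrA.
  exact: Delta2_modular2.
(* Since 2^(p+1) >= p + 1 > 1 / (l e), p + 1 doublings of l x dominate x / e. *)
pose p := Num.truncn (l^-1 / e).
apply: le_lt_trans (h p.+1); apply: modular_mono => n.
have : e^-1 <= 2 ^+ p.+1 * l.
  rewrite -ler_pdivrMr// mulrC; apply: (@le_trans _ _ p.+1%:R).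
    by rewrite ltW// truncnS_gt.
  by rewrite -natrX ler_nat ltnW// ltn_expl.
rewrite !normrM normfV (gtr0_norm e0) (gtr0_norm l0) (@ger0_norm _ (2 ^+ _)) ?exprn_ge0//.
by move=> h'; rewrite mulrA [leLHS]mulrC ler_wpM2r.
Qed.

(** Convexity gives phi(t) <= t phi(1) for t <= 1; the choice t = d / (1 + phi(1) + d) is at most 1
    and makes this at most d. *)
Lemma orlicz_small d : 0 < d ->
  exists2 t : R, 0 < t & forall u, 0 <= u <= t -> (phi u <= d%:E)%E.
Proof.
move=> d0; have p1f : phi 1 \is a fin_num.
  by rewrite ge0_fin_numE ?phi_finite// orlicz_fun_ge0.
have p10 : 0 <= fine (phi 1) by rewrite fine_ge0// orlicz_fun_ge0.
have p11 : 0 < 1 + fine (phi 1) + d by lra.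
exists (d / (1 + fine (phi 1) + d)); first by rewrite divr_gt0.
move=> u /andP[u0 ut].
apply: (le_trans (orlicz_mono phi u0 ut)).
rewrite -[X in phi X]mulr1; apply: le_trans (orlicz_scale _ _ _) _ => //.
  by rewrite divr_ge0 ?(ltW d0) ?(ltW p11)//= ler_pdivrMr//; lra.
rewrite -(fineK p1f) -EFinM lee_fin mulrAC ler_pdivrMr// ler_wpM2l ?(ltW d0)//.
by lra.
Qed.

(** Under Delta2 the modular of x / e is finite for every e > 0, so by domination one tail beyond N
    is below 1/2 for all m at once. The first N terms fall below 1/2 as m grows, since phi is small
    near 0. The modular of y_m / e is then at most 1. *)
Lemma Delta2_dominated_cvg (y : nat -> nat -> R) (x : nat -> R) :
  x \in ell_pred phi -> (forall m n, `|y m n| <= `|x n|) ->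
  (forall n, y m n @[m --> \oo] --> 0) ->
  luxemburg phi (y m) @[m --> \oo] --> 0.
Proof.
move=> xP yx y0; apply/cvgrPdist_le => e e0.
have Ix := Delta2_modular xP e0.
have h0 : (0 < 2^-1%:E :> \bar R)%E by rewrite lte_fin invr_gt0.
have := nneseries_tail_cvg Ix (fun k _ => orlicz_norm_ge0 phi (x k / e)).
move=> /cvge_near_lt/(_ h0)[N _ /(_ N (leqnn _))/= tailN].
have hd M d : 0 < d -> \forall m \near \oo,
    (\sum_(0 <= n < M) phi `|y m n / e|%R <= d%:E)%E.
  elim: M d => [|M ih] d d0.
    by apply: nearW => m; rewrite big_geq// lee_fin ltW.
  have d2 : 0 < d / 2 by rewrite divr_gt0.
  have [t t0 ht] := orlicz_small d2.
  have te : 0 < t * e by rewrite mulr_gt0.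
  have /(cvgr0_norm_le _)/(_ _ te) yM := y0 M.
  near=> m; rewrite big_nat_recr//= [d]splitr EFinD leeD//.
    by near: m; exact: ih.
  apply: ht; rewrite normr_ge0/= normrM normfV (gtr0_norm e0) ler_pdivrMr//.
  by near: m.
near=> m; rewrite sub0r normrN ger0_norm; last first.
  by apply: luxemburg_ge0; exact: ell_pred_le xP.
apply: luxemburg_lbound => //.
rewrite /modular (nneseries_split 0 N); last by move=> *; exact: orlicz_norm_ge0.
rewrite add0n [1%E](_ : _ = (2^-1 : R)%:E + (2^-1 : R)%:E)%E; last first.
  by rewrite -EFinD; congr (_%:E); lra.
rewrite leeD//; first by near: m; apply: hd; rewrite invr_gt0.
apply: le_trans (ltW tailN).
apply: lee_nneseries => [n _ _|n _]; first exact: orlicz_norm_ge0.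
by apply: orlicz_mono => //; rewrite !normrM ler_wpM2r.
Unshelve. all: by end_near. Qed.

End delta2.

(** * Simple functions *)

Section simple.
Context d (T : measurableType d).

Lemma simple_preimage (U : Type) (s : T -> U) (Y : set U) :
  is_simple s -> measurable (s @^-1` Y).
Proof.
move=> [fs ms].
rewrite (_ : _ @^-1` _ = \bigcup_(u in range s `&` Y) s @^-1` [set u]); last first.
  apply/seteqP; split => [x Yx|x [u [_ Yu] /= ->]//].
  by exists (s x) => //; split => //; exists x.
by apply: fin_bigcup_measurable => // ; exact: finite_setIl.
Qed.

Lemma simple_comp (U V : Type) (s : T -> U) (f : U -> V) :
  is_simple s -> is_simple (f \o s).
Proof.
move=> ss; split; first by have := finite_image f ss.1; rewrite image_comp.
by move=> v; rewrite comp_preimage; exact: simple_preimage.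
Qed.

Lemma simple_pair (U V : Type) (s : T -> U) (t : T -> V) :
  is_simple s -> is_simple t -> is_simple (fun x => (s x, t x)).
Proof.
move=> ss st; split.
  apply: (@sub_finite_set _ _ (range s `*` range t)).
    by move=> _ [x _ <-]; split; exists x.
  by apply: finite_setX; [case: ss|case: st].
move=> [u v].
rewrite (_ : _ @^-1` _ = s @^-1` [set u] `&` t @^-1` [set v]); last first.
  by apply/seteqP; split => [x [<- <-]//|x /= [-> ->]].
by apply: measurableI; exact: simple_preimage.
Qed.

Lemma simple_cst (U : Type) (u : U) : is_simple (fun _ : T => u).
Proof.
split; first by apply: (@sub_finite_set _ _ [set u]) => // _ [x _ <-].
move=> v; rewrite preimage_cst; case: ifP => // _; exact: measurableT.
Qed.

Lemma simple_sum (R : realType) (V : normedModType R) (s : nat -> T -> V) n :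
  (forall i, is_simple (s i)) -> is_simple (fun x => \sum_(i < n) s i x).
Proof.
move=> ss; elim: n => [|n ih].
  by under eq_fun do rewrite big_ord0; exact: simple_cst.
under eq_fun do rewrite big_ord_recr/=.
exact: (simple_comp (fun p => p.1 + p.2) (simple_pair ih (ss n))).
Qed.

Lemma simple_measurable_fun d' (U : measurableType d') (s : T -> U) :
  is_simple s -> measurable_fun setT s.
Proof. by move=> ss _ Y mY; rewrite setTI; exact: simple_preimage. Qed.

(** * Integrals of simple functions *)

Section integral.
Context (R : realType) (mu : {finite_measure set T -> \bar R}).

(** The sum runs over the values of [k], not those of [f \o k], so that different functions can be
    integrated over one partition. *)
Lemma integral_simple (U : choiceType) (k : T -> U) (f : U -> R) (E : set T) :
  measurable E -> is_simple k ->
  (\int[mu]_(x in E) (f (k x))%:E =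
   (\sum_(u \in range k) fine (mu (E `&` k @^-1` [set u])) * f u)%:E)%E.
Proof.
move=> mE ks; have [fk mk] := ks.
have mF u : measurable (E `&` k @^-1` [set u]) by exact: measurableI.
have {1}-> : E = \big[setU/set0]_(u <- fset_set (range k)) (E `&` k @^-1` [set u]).
  rewrite bigsetU_fset_set// -setI_bigcupr; apply/esym/setIidPl => x _ /=.
  by exists (k x) => //; exists x.
rewrite integral_bigsetU_EFin//; last 2 first.
- apply/trivIsetP => u v _ _ uv; apply/seteqP; split => // x [[_ /= xu] [_ /= xv]].
  by move: uv; rewrite -xu xv eqxx.
- apply/measurable_EFinP.
  exact: measurable_funS (simple_measurable_fun (simple_comp f ks)).
rewrite fsbig_finite// -sumEFin; apply: eq_bigr => u _.
transitivity (\int[mu]_(x in E `&` k @^-1` [set u]) (cst (f u)%:E) x)%E.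
  by apply: eq_integral => x /set_mem[_ /= ->].
by rewrite integral_cst// mulrC EFinM fineK// fin_num_measure.
Qed.

(** This is [integral_simple] applied to the indicator function of the value v. *)
Lemma measure_simple (U : choiceType) (V : eqType) (k : T -> U) (f : U -> V)
    (E : set T) v : measurable E -> is_simple k ->
  fine (mu (E `&` (f \o k) @^-1` [set v])) =
  \sum_(u <- fset_set (range k) | f u == v) fine (mu (E `&` k @^-1` [set u])).
Proof.
move=> mE ks; have [fk mk] := ks.
have := integral_simple (fun u => (f u == v)%:R) mE ks.
rewrite fsbig_finite//= => h.
rewrite [RHS]big_mkcond/= setIC -integral_indic//; last first.
  exact: (simple_preimage _ (simple_comp f ks)).
transitivity (fine (\int[mu]_(x in E) ((f (k x) == v)%:R)%:E)%E).
  congr fine; apply: eq_integral => x _; rewrite indicE; congr (_%:R%:E).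
  congr nat_of_bool; apply/idP/idP => [/set_mem h1|/eqP h1]; first exact/eqP.
  exact/mem_set.
rewrite h/=; apply: eq_bigr => u _.
by case: eqP => _; rewrite ?mulr1 ?mulr0.
Qed.

Context (V : normedModType R).

(** The level sets of [k] are grouped by their value under [f]. Taking for [k] a pair of simple
    functions puts both on a common partition, whence the additivity of the integral. *)
Lemma simple_integral_comp (U : choiceType) (k : T -> U) (f : U -> V)
    (E : set T) : measurable E -> is_simple k ->
  simple_integral mu E (f \o k) =
  \sum_(u \in range k) fine (mu (E `&` k @^-1` [set u])) *: f u.
Proof.
move=> mE ks; have [fk mk] := ks.
have fkf := (simple_comp f ks).1.
rewrite /simple_integral !fsbig_finite//=.
rewrite [RHS](partition_big_imfset _ f)/=.
have -> : fset_set (range (f \o k)) = [fset f u | u in fset_set (range k)]%fset.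
  by rewrite -fset_set_image// image_comp.
apply: eq_bigr => v _; rewrite measure_simple// scaler_suml.
by apply: eq_bigr => u /eqP ->.
Qed.

Lemma simple_integralB (s t : T -> V) (E : set T) : measurable E ->
  is_simple s -> is_simple t ->
  simple_integral mu E (fun x => s x - t x) =
  simple_integral mu E s - simple_integral mu E t.
Proof.
move=> mE ss st; have st2 := simple_pair ss st.
rewrite (simple_integral_comp (fun p => p.1 - p.2) mE st2).
rewrite (simple_integral_comp (fun p => p.1) mE st2).
rewrite (simple_integral_comp (fun p => p.2) mE st2).
have fp := st2.1.
rewrite !fsbig_finite//= -sumrB; apply: eq_bigr => p _.
by rewrite scalerBr.
Qed.

Lemma simple_integral_cst (v : V) (E : set T) : measurable E ->
  simple_integral mu E (fun=> v) = fine (mu E) *: v.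
Proof.
move=> mE; rewrite /simple_integral.
(* When T is empty the range is empty as well, and both sides vanish. *)
have [[x _]|T0] := pselect (exists x : T, True).
  rewrite (_ : range _ = [set v]); last first.
    by apply/seteqP; split => [_ [? _ <-]//|_ ->]; exists x.
  rewrite fsbig_set1 (_ : _ @^-1` _ = setT) ?setIT//.
  by apply/seteqP; split.
have e0 (A : set T) : A = set0.
  by apply/seteqP; split => // x _; apply: T0; exists x.
by rewrite (e0 setT) image_set0 fsbig_set0 (e0 E) measure0 scale0r.
Qed.

Lemma norm_simple_integral (s : T -> V) (E : set T) : measurable E ->
  is_simple s ->
  ((`|simple_integral mu E s|)%:E <= \int[mu]_(x in E) (`|s x|)%:E)%E.
Proof.
move=> mE ss; rewrite (integral_simple Num.norm mE ss) lee_fin.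
have fs := ss.1.
rewrite /simple_integral !fsbig_finite//=; apply: le_trans (ler_norm_sum _ _ _) _.
apply: ler_sum => v _; rewrite normrZ ger0_norm// fine_ge0//.
Qed.

End integral.

Section measurable_norm.
Context (R : realType) (V : normedModType R).

(** No sigma-algebra is put on V: measurability is obtained for the scalar function, as a pointwise
    limit of scalar simple functions. *)
Lemma measurable_normB (g s : T -> V) : strongly_measurable g -> is_simple s ->
  measurable_fun setT (fun x => `|g x - s x|).
Proof.
move=> [t ts tg] ss; apply: (@measurable_fun_cvg _ _ _ _ (fun n x => `|t n x - s x|)).
  move=> n; apply: simple_measurable_fun.
  exact: (simple_comp (fun p => `|p.1 - p.2|) (simple_pair (ts n) ss)).
by move=> x _; apply: cvg_norm; apply: cvgB (tg x) _; exact: cvg_cst.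
Qed.

End measurable_norm.

End simple.

(** * Coordinates and their densities *)

Section coordinates.
Context (R : realType) (phi : orlicz R).
Implicit Types x y : ell phi.

Lemma ell_subE x y n : (x - y) n = x n - y n. Proof. by []. Qed.
Lemma ell_scaleE (a : R) x n : (a *: x) n = a * x n. Proof. by []. Qed.

Lemma ell_sumE (I : Type) (r : seq I) (P : pred I) (F : I -> ell phi) n :
  (\sum_(i <- r | P i) F i) n = \sum_(i <- r | P i) F i n.
Proof. by elim/big_rec2: _ => // i _ a _ <-. Qed.

Lemma ell_norm_le x y : (forall n, `|y n| <= `|x n|) -> `|y| <= `|x|.
Proof. by move=> yx; apply: luxemburg_mono (ell_valP x). Qed.

Lemma cvg_coord (F : set_system nat) {FF : Filter F} (y : nat -> ell phi) x n :
  y m @[m --> F] --> x -> y m n @[m --> F] --> x n.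
Proof.
move=> yx; have [C C0 hC] := coord_bound phi.
apply/cvgrPdist_le => e e0; have eC : 0 < e / C by rewrite divr_gt0.
have /cvgrPdist_le/(_ _ eC) := yx; apply: filterS => m.
by rewrite ler_pdivlMr// mulrC; apply: le_trans; rewrite -ell_subE.
Qed.

Hypothesis phi_finite : finite_orlicz phi.

Lemma unit_vector_pred k : (fun n => (n == k)%:R) \in ell_pred phi.
Proof.
apply/asboolP; exists 1 => //; rewrite /modular.
rewrite (nneseries_split 0 k.+1); last by move=> *; exact: orlicz_norm_ge0.
rewrite add0n eseries0 ?adde0 ?lte_sum_pinfty//.
  by move=> n _; exact: phi_finite.
move=> n kn _; rewrite gtn_eqF// mulr0 normr0 (orlicz0 (orliczP phi))//.
Qed.

Definition unit_vector k : ell phi := Ell (unit_vector_pred k).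

Lemma sum_unit_vectorE (a : nat -> R) N n :
  (\sum_(k < N) a k *: unit_vector k) n = if (n < N)%N then a n else 0.
Proof.
rewrite ell_sumE; under eq_bigr do rewrite ell_scaleE/=.
have [nN|Nn] := ltnP n N.
  rewrite (bigD1 (Ordinal nN))//= eqxx mulr1 big1 ?addr0// => i /eqP ni.
  by case: eqP => [nk|]; rewrite ?mulr0//; case: ni; apply/val_inj.
rewrite big1// => i _; case: eqP => [nk|]; rewrite ?mulr0//.
by have := ltn_ord i; rewrite -nk ltnNge Nn.
Qed.

End coordinates.

Section vector_measure.
Context d (T : measurableType d) (R : realType).

(** For the constant sequence of empty sets the partial sums converge, so their consecutive
    differences, all equal to [G set0], tend to 0. *)
Lemma vector_measure0 (V : normedModType R) (G : set T -> V) :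
  vector_measure G -> G set0 = 0.
Proof.
move=> vG; have := vG (fun=> set0) (fun=> measurable0) (@trivIset_set0 _ _ _).
rewrite bigcup0// => u0; pose u (n : nat) := \sum_(0 <= i < n) G set0.
have u1 : u n.+1 @[n --> \oo] --> G set0 by rewrite (cvg_shiftS u).
have h : (u n.+1 - u n) @[n --> \oo] --> G set0 - G set0 by exact: cvgB.
rewrite subrr (_ : (fun n => _) = cst (G set0)) in h; last first.
  by apply/funext => n; rewrite /u big_nat_recr//= addrAC subrr add0r.
 apply: (cvg_unique _ _ h); [exact: norm_hausdorff|exact: cvg_cst].
Qed.

Context (phi : orlicz R) (mu : {finite_measure set T -> \bar R}).
Variable G : set T -> ell phi.
Hypotheses (vG : vector_measure G) (cG : mu_continuous mu G).

Lemma coord_density n : exists f : T -> R, mu.-integrable setT (EFin \o f) /\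
  forall E, measurable E -> (\int[mu]_(x in E) (f x)%:E = (G E n)%:E)%E.
Proof.
pose nu (E : set T) : \bar R := (G E n)%:E.
have nu0 : nu set0 = 0%E by rewrite /nu vector_measure0.
have nu_fin E : measurable E -> nu E \is a fin_num by [].
have nu_add : semi_sigma_additive nu.
  move=> F mF tF _; under eq_fun do rewrite sumEFin -ell_sumE.
  by apply: cvg_EFin; [exact: nearW|exact: cvg_coord (vG mF tF)].
pose nuC : {charge set T -> \bar R} :=
  HB.pack nu (isCharge.Build _ _ _ nu nu0 nu_fin nu_add).
have numu : nuC `<< mu.
  (* A null set has measure below every threshold k, so [mu_continuous] bounds its image by every e
     > 0. *)
  apply/null_content_dominatesP => E mE muE.
  suff : G E = 0 by rewrite /nuC/= /nu => ->.
  apply/normr0_eq0/le_anti; rewrite normr_ge0 andbT.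
  apply/ler_addgt0Pr => e e0; rewrite add0r.
  have [k k0 h] := cG e0; apply/ltW/h => //.
  by rewrite muE lte_fin.
exists (fine \o Radon_Nikodym nuC mu).
have fE : EFin \o (fine \o Radon_Nikodym nuC mu) = Radon_Nikodym nuC mu.
  by apply/funext => x /=; rewrite fineK// Radon_Nikodym_fin_num.
split; first by rewrite fE; exact: Radon_Nikodym_integrable.
move=> E mE; rewrite -[RHS]/(nuC E) (Radon_Nikodym_integral numu mE).
by apply: eq_integral => x _; rewrite -[RHS]/((Radon_Nikodym nuC mu) x) -fE.
Qed.

End vector_measure.

(** * Approximation of real functions by simple functions *)

Section real_approx.
Context d (T : measurableType d) (R : realType).
Import HBNNSimple.

Lemma simple_approx_ge0 (f : T -> R) : measurable_fun setT f ->
  (forall x, 0 <= f x) ->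
  exists s : nat -> T -> R, [/\ forall n, is_simple (s n),
    forall n x, 0 <= s n x <= f x,
    forall x, {homo s^~ x : m n / (m <= n)%N >-> m <= n} &
    forall x, s n x @[n --> \oo] --> f x].
Proof.
move=> mf f0; have mEf : measurable_fun setT (EFin \o f) by exact/measurable_EFinP.
pose s := nnsfun_approx measurableT mEf.
have sm x : {homo (fun n => s n x) : m n / (m <= n)%N >-> m <= n}.
  by move=> m n mn; exact/lefP/nd_nnsfun_approx.
have sf x : s n x @[n --> \oo] --> f x.
  apply: (@fine_cvg _ _ _ _ (EFin \o s^~ x)).
  by apply: cvg_nnsfun_approx => // y _; rewrite lee_fin.
exists s; split => //.

move=> n x; apply/andP; split; first exact: fun_ge0.
rewrite -(cvg_lim _ (sf x))//.
exact: (nondecreasing_cvgn_le (sm x) (cvgP _ (sf x))).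
Qed.

(** The inequality s^2 <= s f encodes that s lies between 0 and f, in a form that can be integrated
    over level sets of s. The positive and negative parts of f are approximated separately from
    below; at each point one of them is 0, so no cancellation spoils monotonicity. *)
Lemma simple_approx (f : T -> R) : measurable_fun setT f ->
  exists s : nat -> T -> R, [/\ forall n, is_simple (s n),
    forall n x, s n x * s n x <= s n x * f x,
    forall x, {homo (fun n => `|s n x|) : m n / (m <= n)%N >-> m <= n} &
    forall x, s n x @[n --> \oo] --> f x].
Proof.
move=> mf.
have [p [ps p0 pm pf]] := simple_approx_ge0 (measurable_funrpos mf) (funrpos_ge0 f).
have [q [qs q0 qm qf]] := simple_approx_ge0 (measurable_funrneg mf) (funrneg_ge0 f).
exists (fun n x => p n x - q n x); split.
- move=> n; exact: (simple_comp (fun u => u.1 - u.2) (simple_pair (ps n) (qs n))).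
- move=> n x; have /andP[] := p0 n x; have /andP[] := q0 n x.
  rewrite /funrpos /funrneg /Num.max; case: ltP => h1; case: ltP => h2; nra.
- move=> x m n mn; have := pm x _ _ mn; have := qm x _ _ mn.
  have /andP[] := p0 n x; have /andP[] := q0 n x.
  have /andP[] := p0 m x; have /andP[] := q0 m x.
  have := ler_norm (p n x - q n x); have := ler_norm (- (p n x - q n x)).
  rewrite normrN ler_norml /funrpos /funrneg /Num.max.
  case: ltP => h1; case: ltP => h2; lra.
- move=> x; have -> : f x = f^\+ x - f^\- x by rewrite -{1}(funrposBneg f).
  exact: cvgB.
Qed.

End real_approx.

(** * Densities under Delta2 *)

Lemma sum_variation d (T : measurableType d) (R : realType)
    (V : normedModType R) (G : set T -> V) (U : choiceType) (k : T -> U) :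
  is_simple k ->
  ((\sum_(u \in range k) `|G (k @^-1` [set u])|)%:E <= vector_variation G setT)%E.
Proof.
move=> [fk mk]; apply: ereal_sup_ubound => /=.
(* A point of T supplies the default value of [nth]; an empty T is partitioned into no pieces. *)
have [[x0 _]|T0] := pselect (exists x : T, True); last first.
  exists 0%N, (fun=> set0); split => //.
  - by apply/seteqP; split => // x; case: T0; exists x.
  rewrite big_ord0 (_ : range k = set0) ?fsbig_set0//.
  by apply/seteqP; split => // v [x _ _]; case: T0; exists x.
set r := fset_set (range k).
exists (size r), (fun i => k @^-1` [set nth (k x0) r i]); split => //.
- apply/trivIsetP => i j /= ir jr ij; apply/seteqP; split => // x [/= xi xj].
  move: ij; rewrite -(nth_uniq (k x0) ir jr) ?fset_uniq//.
  by rewrite -xi -xj eqxx.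
- apply/seteqP; split => // x _ /=.
  have kr : k x \in (r : seq U) by rewrite in_fset_set//; apply/mem_set; exists x.
  by exists (index (k x) r); rewrite /= ?index_mem// nth_index.
- rewrite fsbig_finite//= -/r; congr (_%:E).
  by rewrite (big_nth (k x0)) big_mkord.
Qed.

Lemma ler_norm_sqr (R : realDomainType) (a b : R) : a * a <= b * b -> `|a| <= `|b|.
Proof.
by move=> ab; rewrite -ler_sqr ?nnegrE// !real_normK ?num_real// !expr2.
Qed.

Section delta2_rnp.
Context (R : realType) (phi : orlicz R).
Hypotheses (phi_finite : finite_orlicz phi) (D2 : Delta2_0 phi).
Context d (T : measurableType d) (mu : {finite_measure set T -> \bar R}).
Variable G : set T -> ell phi.
Hypothesis vG : (vector_variation G setT < +oo)%E.
Variables (f : nat -> T -> R) (s : nat -> nat -> T -> R).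
Hypotheses (fi : forall n, mu.-integrable setT (EFin \o f n))
  (fG : forall n E, measurable E -> (\int[mu]_(x in E) (f n x)%:E = (G E n)%:E)%E)
  (ss : forall n N, is_simple (s n N))
  (sf : forall n N x, s n N x * s n N x <= s n N x * f n x)
  (sm : forall n x, {homo (fun N => `|s n N x|) : i j / (i <= j)%N >-> i <= j})
  (sc : forall n x, s n N x @[N --> \oo] --> f n x).

Let e := unit_vector phi_finite.
Definition approx_ell N (x : T) : ell phi := \sum_(k < N) s k N x *: e k.
Local Notation h := approx_ell.

Lemma approx_ellE N x n : h N x n = if (n < N)%N then s n N x else 0.
Proof. exact: (sum_unit_vectorE phi_finite (fun k => s k N x)). Qed.

Lemma approx_ell_sq N x n : h N x n * h N x n <= h N x n * f n x.
Proof. by rewrite approx_ellE; case: ifP => // _; rewrite !mul0r. Qed.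

Lemma approx_ell_le N x n : `|h N x n| <= `|f n x|.
Proof.
by apply: ler_norm_sqr; have := approx_ell_sq N x n; nra.
Qed.

Lemma approx_ell_simple N : is_simple (h N).
Proof.
apply: (@simple_sum _ _ _ _ (fun k x => s k N x *: e k)) => k.
exact: (simple_comp (fun a => a *: e k) (ss k N)).
Qed.

Lemma approx_ell_mono x : {homo (fun N => `|h N x|) : i j / (i <= j)%N >-> i <= j}.
Proof.
move=> i j ij; apply: ell_norm_le => n; rewrite !approx_ellE.
case: ifP => [ni|_]; last by rewrite normr0.
by rewrite (leq_trans ni ij); exact: sm.
Qed.

Lemma approx_ell_cvg x n : h N x n @[N --> \oo] --> f n x.
Proof.
apply: cvg_trans (@sc n x); apply: near_eq_cvg.
by near=> N; rewrite approx_ellE ifT//; near: N; exact: nbhs_infty_gt.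
Unshelve. all: by end_near. Qed.

Lemma approx_ell_level N v : range (h N) v ->
  fine (mu (h N @^-1` [set v])) * `|v| <= `|G (h N @^-1` [set v])|.
Proof.
set A := _ @^-1` _ => -[x0 _ hv].
have mA : measurable A by case: (approx_ell_simple N) => _; apply.
have mu0 : 0 <= fine (mu A) by exact: fine_ge0.
rewrite -{1}(ger0_norm mu0) -normrZ; apply: ell_norm_le => n.
rewrite ell_scaleE normrM (ger0_norm mu0).
(* Integrating h_n^2 <= h_n f_n over A, where h = v, gives v_n^2 mu(A) <= v_n G(A)_n; dividing by
   |v_n| yields the coordinate inequality. *)
have : (\int[mu]_(x in A) (v n * v n)%:E <=
    \int[mu]_(x in A) ((v n)%:E * (f n x)%:E))%E.
  apply: le_integral => //.
  - apply/integrableP; split; first exact: measurable_cst.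
    by rewrite integral_cst// lte_mul_pinfty// ltey_eq fin_num_measure.
  - apply: integrableZl => //; exact: integrableS (fi n).
  - by move=> x /set_mem <-; rewrite -EFinM lee_fin; exact: approx_ell_sq.
rewrite integral_cst// integralZl//; last exact: integrableS (fi n).
rewrite fG// => leG.
have {leG} : v n * v n * fine (mu A) <= v n * G A n.
  by rewrite -lee_fin EFinM [leRHS]EFinM fineK ?fin_num_measure.
have [vn0|vn0] := eqVneq (v n : R) 0.
  by move=> _; rewrite vn0 normr0 mulr0 normr_ge0.
have v0 : 0 < `|v n| by rewrite normr_gt0.
move=> le1; rewrite -(ler_pM2l v0) -normrM; apply: le_trans (ler_norm _).
apply: le_trans le1; rewrite mulrCA -normrM ger0_norm 1?mulrC//.
by rewrite -expr2 sqr_ge0.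
Qed.

Lemma integral_approx_ell N :
  (\int[mu]_x (`|h N x|)%:E <= vector_variation G setT)%E.
Proof.
have hs := approx_ell_simple N.
rewrite (integral_simple mu Num.norm measurableT hs).
apply: le_trans (sum_variation G hs).
have fh := hs.1; rewrite lee_fin !fsbig_finite//= big_seq [leRHS]big_seq.
apply: ler_sum => v; rewrite in_fset_set// => /set_mem hv.
by rewrite setTI; exact: approx_ell_level.
Qed.

(** The limit is taken in the extended reals, where the increasing norms always converge; it may be
    infinite at some points. *)
Definition approx_sup (x : T) : \bar R := limn (fun N => (`|h N x|)%:E).

Lemma approx_sup_cvg x : (`|h N x|)%:E @[N --> \oo] --> approx_sup x.
Proof.
apply: ereal_nondecreasing_is_cvgn => i j ij; rewrite lee_fin.
exact: approx_ell_mono.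
Qed.

Lemma approx_sup_ge N x : ((`|h N x|)%:E <= approx_sup x)%E.
Proof.
apply: lime_ge; first exact: approx_sup_cvg.
by exists N => // j /= Nj; rewrite lee_fin; exact: approx_ell_mono.
Qed.

Lemma measurable_norm_approx N : measurable_fun setT (fun x => (`|h N x|)%:E).
Proof.
apply: simple_measurable_fun.
exact: (simple_comp (fun v => `|v|%:E) (approx_ell_simple N)).
Qed.

Lemma integrable_approx_sup : mu.-integrable setT approx_sup.
Proof.
have sup0 x : (0 <= approx_sup x)%E.
  by apply: le_trans (approx_sup_ge 0 x); rewrite lee_fin.
apply/integrableP; split.
  apply: (emeasurable_fun_cvg _ _ measurable_norm_approx) => x _.
  exact: approx_sup_cvg.
under eq_integral do rewrite gee0_abs//.
apply: le_lt_trans vG.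
rewrite monotone_convergence//.
- apply: lime_le; last by apply: nearW => N; exact: integral_approx_ell.
  apply: ereal_nondecreasing_is_cvgn => i j ij; apply: ge0_le_integral => //.
  + exact: measurable_norm_approx.
  + exact: measurable_norm_approx.
  + by move=> x _; rewrite lee_fin; exact: approx_ell_mono.
- exact: measurable_norm_approx.
- by move=> x _ i j ij; rewrite lee_fin; exact: approx_ell_mono.
Qed.

Lemma density_exists : exists2 g : T -> ell phi, bochner_integrable mu g &
  forall E, measurable E -> is_bochner_integral mu E g (G E).
Proof.
have [N [mN N0 subN]] := integrable_ae measurableT integrable_approx_sup.
have sup0 x : (0 <= approx_sup x)%E.
  by apply: le_trans (approx_sup_ge 0 x); rewrite lee_fin.
(* N is a null set off which [approx_sup] is finite. Cutting the densities to 0 on N gives a member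
   of the space at every point, and lets the cut approximations converge everywhere, as strong
   measurability demands. *)
pose ind x : R := \1_(~` N) x.
pose c x n : R := ind x * f n x.
(* Off N this is the Fatou property along [h k x]. On N, where [fine] may return its default 0, the
   sequence is 0 and the bound still holds. *)
have gP x : c x \in ell_pred phi /\ luxemburg phi (c x) <= fine (approx_sup x).
  rewrite /c /ind indicE; case: (boolP (x \in ~` N)) => [/set_mem xN|_].
    have supfin : approx_sup x \is a fin_num.
      by apply: contrapT => h1; apply: xN; apply: subN => /= h2; exact: h1 (h2 I).
    under eq_fun do rewrite mul1r.
    apply: (@luxemburg_fatou _ _ (fun k => h k x : nat -> R)).
    - by move=> k; exact: ell_valP.
    - by move=> n; exact: approx_ell_cvg.
    - exact: fine_ge0.
    - apply: nearW => k; rewrite -lee_fin fineK//; exact: approx_sup_ge.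
  under eq_fun do rewrite mul0r.
  split; first exact: (ell_valP (0 : ell phi)).
  have -> : luxemburg phi (fun=> 0) = `|0 : ell phi| by [].
  by rewrite normr0 fine_ge0.
pose g x : ell phi := Ell (gP x).1.
pose H k x := ind x *: h k x.
have inds : is_simple ind.
  split; first by rewrite /ind; exact: fimfunP.
  move=> v; rewrite -[X in measurable X]setTI.
  exact: (measurable_indic (measurableC mN)).
have Hs k : is_simple (H k).
  exact: (simple_comp (fun p => p.1 *: p.2) (simple_pair inds (approx_ell_simple k))).
(* Coordinatewise H lies between 0 and g, so g itself dominates g - H. *)
have Hg_le k x n : `|(g x - H k x) n| <= `|g x n|.
  rewrite ell_subE ell_scaleE /= /c -mulrBr !normrM ler_wpM2l//.
  by apply: ler_norm_sqr; have := approx_ell_sq k x n; nra.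
have Hg0 x : `|g x - H k x| @[k --> \oo] --> 0.
  apply: (@Delta2_dominated_cvg _ _ phi_finite D2
    (fun k => (g x - H k x) : nat -> R) (c x)).
  - exact: (gP x).1.
  - by move=> k n; exact: Hg_le.
  - move=> n; rewrite -(subrr (c x n)).
    apply: cvgB; first exact: cvg_cst.
    by apply: cvgMr; exact: approx_ell_cvg.
have Hg x : H k x @[k --> \oo] --> g x.
  apply/cvgrPdist_le => r r0; have /cvgr0_norm_le/(_ _ r0) := Hg0 x.
  by apply: filterS => k; rewrite normr_id.
have gS : strongly_measurable g by exists H.
have I0 : (\int[mu]_x (`|g x - H k x|%:E))%E @[k --> \oo] --> 0%E.
  have mf k : measurable_fun setT (fun x => `|g x - H k x|%:E).
    by apply/measurable_EFinP; exact: measurable_normB.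
  have cvg_ae : {ae mu, forall x, setT x ->
      (`|g x - H k x|%:E)%E @[k --> \oo] --> cst 0%E x}.
    by apply: aeW => x _; apply: cvg_EFin; [exact: nearW|exact: Hg0].
  have dom_ae : {ae mu, forall x k, setT x ->
      (`| (`|g x - H k x|)%:E | <= approx_sup x)%E}.
    apply: aeW => x k _; rewrite /= normr_id.
    apply: (@le_trans _ _ (`|g x|%:E)); first by rewrite lee_fin; exact: ell_norm_le.
    have [supfin|] := boolP (approx_sup x \is a fin_num).
      by rewrite -(fineK supfin) lee_fin; exact: (gP x).2.
    by rewrite ge0_fin_numE// -leNgt leye_eq => /eqP ->; rewrite leey.
  have /= [_ _] := dominated_convergence measurableT mf (measurable_cst _)
    cvg_ae integrable_approx_sup dom_ae.
  by rewrite integral0.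
exists g; first by split => //; exists H.
move=> E mE; exists H => //.
pose S k := simple_integral mu E (H k).
(* Scalar dominated convergence, with dominant |f_n|, identifies the limit of each coordinate. *)
have Sc n : S k n @[k --> \oo] --> G E n.
  have SE k : (\int[mu]_(x in E) (H k x n)%:E = (S k n)%:E)%E.
    rewrite (integral_simple mu (fun v : ell phi => v n) mE (Hs k)); congr (_%:E).
    have fH := (Hs k).1; rewrite /S /simple_integral !fsbig_finite//= ell_sumE.
    by apply: eq_bigr.
  have mf k : measurable_fun E (fun x => (H k x n)%:E).
    apply/measurable_EFinP; apply: measurable_funTS.
    exact: (simple_measurable_fun (simple_comp (fun v : ell phi => v n : R) (Hs k))).
  have fiE := integrableS measurableT mE (@subsetT _ E) (fi n).
  have cvg_ae : {ae mu, forall x, E x ->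
      (H k x n)%:E @[k --> \oo] --> (f n x)%:E}.
    exists N; split => // x /= hx; apply: contrapT => xN; apply: hx => _.
    have -> : (fun k => (H k x n)%:E) = (fun k => (h k x n)%:E).
      by apply/funext => k; rewrite ell_scaleE /ind indicE mem_set ?mul1r.
    by apply: cvg_EFin; [exact: nearW|exact: approx_ell_cvg].
  have dom_ae : {ae mu, forall x k, E x ->
      (`| (H k x n)%:E | <= `|(f n x)%:E|)%E}.
    apply: aeW => x k _; rewrite abse_EFin lee_fin /H ell_scaleE normrM.
    apply: le_trans (approx_ell_le k x n); rewrite ler_piMl// /ind indicE.
    by rewrite ger0_norm// lern1 leq_b1.
  have /= [_ _] := dominated_convergence mE mf (measurable_int _ fiE)
    cvg_ae (integrable_abse fiE) dom_ae.
  rewrite fG//; under eq_fun do rewrite SE.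
  exact: fine_cvg.
(* To pass from coordinates to the norm, fix a large k: as m grows, S_m - S_k tends coordinatewise
   to G(E) - S_k and its norm is eventually at most r by the L^1 convergence, so the Fatou property
   bounds the norm of the limit by r. *)
apply/cvgrPdist_le => r r0.
have r2 : (0 < (r / 2)%:E)%E by rewrite lte_fin divr_gt0.
have [k0 _ hk0] := cvge_near_lt I0 r2.
exists k0 => // k /= k0k.
apply: (@luxemburg_fatou _ _ (fun m => (S m - S k) : nat -> R) (G E - S k) r
  _ _ (ltW r0) _).2.
- by move=> m; exact: ell_valP.
- by move=> n; apply: cvgB; [exact: Sc|exact: cvg_cst].
exists k0 => // m /= k0m.
rewrite -lee_fin; have mgH j := measurable_normB gS (Hs j).
rewrite -[leLHS]/(`|S m - S k|%:E) -simple_integralB//.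
have HHs : is_simple (fun x => H m x - H k x).
  exact: (simple_comp (fun p => p.1 - p.2) (simple_pair (Hs m) (Hs k))).
apply: (le_trans (norm_simple_integral mu mE HHs)).
apply: (@le_trans _ _ (\int[mu]_x (`|g x - H m x|%:E + `|g x - H k x|%:E))%E).
  apply: (@le_trans _ _ (\int[mu]_x (`|H m x - H k x|%:E))%E).
    apply: ge0_subset_integral => //.
    apply/measurable_EFinP; exact: (simple_measurable_fun (simple_comp Num.norm HHs)).
  apply: ge0_le_integral => //.
  - apply/measurable_EFinP; exact: (simple_measurable_fun (simple_comp Num.norm HHs)).
  - by apply: emeasurable_funD; apply/measurable_EFinP.
  - move=> x _; rewrite -EFinD lee_fin.
    rewrite (_ : H m x - H k x = (g x - H k x) - (g x - H m x)).
      by rewrite [leRHS]addrC; exact: ler_normB.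
    by rewrite opprB [RHS]addrC addrA subrK.
rewrite ge0_integralD//; [|by apply/measurable_EFinP..].
by rewrite [r]splitr EFinD leeD// ltW//; exact: hk0.
Qed.

End delta2_rnp.

Lemma Delta2_RNP (R : realType) (phi : orlicz R) :
  finite_orlicz phi -> Delta2_0 phi -> radon_nikodym_property (ell phi).
Proof.
move=> phi_finite D2 d T mu G mG vG cG.
have [f fP] := choice (coord_density mG cG).
have mf n : measurable_fun setT (f n).
  by apply/measurable_EFinP; exact: measurable_int (fP n).1.
have [s sP] := choice (fun n => simple_approx (mf n)).
apply: (@density_exists R phi phi_finite D2 d T mu G vG f s) => n.
- exact: (fP n).1.
- exact: (fP n).2.
- by case: (sP n).
- by case: (sP n).
- by case: (sP n).
- by case: (sP n).
Qed.

(** * Measures without density when Delta2 fails *)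

(** The index of j is the least k such that j lies before the end of block k. It exists because
    blocks of positive length make the k-th partial sum at least k. *)
Lemma block_index (m : nat -> nat) : (forall k, 0 < m k)%N ->
  exists b : nat -> nat, forall k j,
    (\sum_(i < k) m i <= j < \sum_(i < k.+1) m i)%N -> b j = k.
Proof.
move=> m0; pose M k := (\sum_(i < k) m i)%N.
have MS k : M k.+1 = (M k + m k)%N by rewrite /M big_ord_recr.
have Mm : {homo M : i j / (i <= j)%N}.
  move=> i j; elim: j => [|j ih]; first by rewrite leqn0 => /eqP ->.
  rewrite leq_eqVlt => /orP[/eqP->//|/ih h]; rewrite MS.
  exact: leq_trans h (leq_addr _ _).
have Mge k : (k <= M k)%N.
  by elim: k => // k ih; rewrite MS -addn1 leq_add.
have ex j : exists k, (j < M k.+1)%N by exists j; exact: Mge.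
exists (fun j => ex_minn (ex j)) => k j /andP[kj jk].
case: ex_minnP => k' jk' /(_ _ jk) k'k; apply/eqP; rewrite eqn_leq k'k/=.
rewrite leqNgt; apply/negP => lt_k'k.
have := leq_trans jk' (Mm _ _ lt_k'k).
by rewrite ltnNge kj.
Qed.

Section not_delta2.
Context (R : realType) (phi : orlicz R).
Hypotheses (phi_finite : finite_orlicz phi) (ND2 : ~ Delta2_0 phi).

Lemma orlicz_fin_num u : 0 <= u -> phi u \is a fin_num.
Proof. by move=> u0; rewrite ge0_fin_numE ?phi_finite ?orlicz_fun_ge0. Qed.

(** Failure of Delta2 gives u with phi(2u) much larger than phi(u). Repeating u about 1 / phi(2u)
    times brings the sum at 2u up to 1 while the sum at u stays small. *)
Lemma not_Delta2_scales (c : R) : 0 < c -> exists um : R * nat,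
  [/\ 0 <= um.1, (0 < um.2)%N, um.2%:R * fine (phi um.1) <= c &
    1 <= um.2%:R * fine (phi (2 * um.1))].
Proof.
move=> c0; have [u0 u0_gt0 /eqP pu0] := orlicz_neq0 (orliczP phi).
have pu0_gt0 : (0 < phi u0)%E by rewrite lt0e pu0 orlicz_fun_ge0// ltW.
set B := fine (phi (2 * u0)).
have B0 : 0 <= B by rewrite fine_ge0// orlicz_fun_ge0// mulr_ge0// ltW.
(* The 3 ensures K > 2. The other term pays for rounding 1 / phi(2u) up to an integer, which costs a
   factor at most 1 + phi(2u) <= 1 + B because u <= u0. *)
pose K := 3 + (1 + B) / c.
have B1c : 0 < (1 + B) / c by rewrite divr_gt0//; lra.
have K0 : 0 < K by rewrite /K; lra.
have [u [/andP[u_ge0 uu0] hu]] : exists u,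
    0 <= u <= u0 /\ (K%:E * phi u < phi (2 * u)%R)%E.
  apply: contrapT => h; apply: ND2; exists K, u0; split.
  - by rewrite /K; lra.
  - exact: ltW.
  - by rewrite pu0_gt0 phi_finite// ltW.
  - by move=> u hu; rewrite leNgt; apply/negP => hu'; apply: h; exists u.
have u2 : 0 <= 2 * u by rewrite mulr_ge0.
have bB : fine (phi (2 * u)) <= B.
  rewrite fine_le ?orlicz_fin_num//; first by rewrite mulr_ge0// ltW.
  by apply: orlicz_mono => //; rewrite ler_pM2l.
have a0 : 0 <= fine (phi u) by rewrite fine_ge0// orlicz_fun_ge0.
move: hu; rewrite -(fineK (orlicz_fin_num u_ge0)) -(fineK (orlicz_fin_num u2)).
set a := fine (phi u) in a0 *; set b := fine (phi (2 * u)) in bB *.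
rewrite -EFinM lte_fin => Kab.
have b0 : 0 < b by apply: le_lt_trans Kab; rewrite mulr_ge0// ltW.
have ab : a * (1 + B) <= c * b.
  rewrite [leRHS]mulrC -ler_pdivrMr// -mulrA; apply: ltW; apply: le_lt_trans Kab.
  by rewrite /K; nra.
have b_inv0 : 0 <= b^-1 by rewrite invr_ge0 ltW.
exists (u, (Num.truncn b^-1).+1); split => //=; last first.
  by rewrite -ler_pdivrMr// mul1r ltW// truncnS_gt.
rewrite -/a -natr1; apply: (@le_trans _ _ ((b^-1 + 1) * a)).
  by rewrite ler_wpM2r// lerD2r// truncn_le.
have -> : (b^-1 + 1) * a = a * (1 + b) / b by field; rewrite gt_eqF.
rewrite ler_pdivrMr//; apply: le_trans ab; rewrite ler_wpM2l//; lra.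
Qed.

(* Hence a |-> (a_(b j) x_j)_j embeds l^oo, with
   sup |a_k| / 2 <= ||(a_(b j) x_j)_j|| <= sup |a_k|. *)
Lemma not_Delta2_blocks : exists (x : nat -> R) (b : nat -> nat),
  (modular phi x <= 1)%E /\
  forall (y : ell phi) k c, 0 <= c ->
    (forall j, b j = k -> c * `|x j| <= `|y j|) -> c / 2 <= `|y|.
Proof.
(* These bounds on the modulars of the blocks sum to at most 1. *)
have c0 k : 0 < 2^-1 ^+ k.+1 :> R by rewrite exprn_gt0// invr_gt0.
have [um umP] := choice (fun k => not_Delta2_scales (c0 k)).
pose u k := (um k).1; pose m k := (um k).2.
have u0 k : 0 <= u k by case: (umP k).
have m0 k : (0 < m k)%N by case: (umP k).
have [b bP] := block_index m0.
pose M k := (\sum_(i < k) m i)%N.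
have MS k : M k.+1 = (M k + m k)%N by rewrite /M big_ord_recr.
have Mge k : (k <= M k)%N.
  by elim: k => // k ih; rewrite MS -addn1 leq_add.
have block (p : R -> \bar R) k :
    (\sum_(M k <= j < M k.+1) p (u (b j)) = \sum_(i < m k) p (u k))%E.
  rewrite (eq_big_nat _ _ (F2 := fun=> p (u k))); last by move=> j /bP ->.
  by rewrite MS -{1}[M k]add0n big_addn addKn big_mkord.
exists (fun j => u (b j)), b; split.
  have sumM K : (\sum_(0 <= j < M K) phi `|u (b j)|%R <= (1 - 2^-1 ^+ K)%:E)%E.
    elim: K => [|K ih]; first by rewrite /M big_ord0 big_geq// expr0 subrr.
    rewrite (@big_cat_nat _ _ _ (M K))//=; last by rewrite MS leq_addr.
    rewrite (block (fun t => phi `|t|%R)).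
    have -> : 1 - 2^-1 ^+ K.+1 = (1 - 2^-1 ^+ K) + 2^-1 ^+ K.+1 :> R.
      by rewrite exprS; lra.
    rewrite EFinD leeD// ger0_norm// -(fineK (orlicz_fin_num (u0 K))).
    rewrite sumEFin lee_fin sumr_const card_ord -[leLHS]mulr_natl.
    by case: (umP K).
  apply: modular_le => N.
  apply: (@le_trans _ _ (\sum_(0 <= j < M N) phi `|u (b j)|%R)%E).
    by apply: lee_sum_nneg_natr => // *; exact: orlicz_norm_ge0.
  by apply: le_trans (sumM N) _; rewrite lee_fin gerBl exprn_ge0.
move=> y k c c_ge0 yP; rewrite leNgt; apply/negP => yc.
have [e [ye ec]] : exists e, `|y| < e /\ e < c / 2.
  by exists ((`|y| + c / 2) / 2); lra.
have e0 : 0 < e := le_lt_trans (normr_ge0 y) ye.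
have := luxemburg_lt_modular (ell_valP y) ye; apply/negP; rewrite -ltNge.
(* On block k, |y_j| / e >= (c / (2e)) 2 u_k with c / (2e) > 1. Convexity takes the factor out of
   phi, so the block alone contributes at least c / (2e) > 1 to the modular of y / e. *)
have c2e : 1 < c / (2 * e) by rewrite ltr_pdivlMr ?mulr_gt0//; lra.
apply: (@lt_le_trans _ _ (c / (2 * e))%:E); first by rewrite lte_fin.
apply: le_trans (modular_ge _ _ (M k.+1)).
rewrite (@big_cat_nat _ _ _ (M k))//=; last by rewrite MS leq_addr.
rewrite -[leLHS]add0e leeD//.
  by apply: sume_ge0 => *; exact: orlicz_norm_ge0.
apply: (@le_trans _ _
  (\sum_(M k <= j < M k.+1) (c / (2 * e))%:E * phi (2 * u (b j))%R)%E).
  rewrite (block (fun t => (c / (2 * e))%:E * phi (2 * t)%R)%E).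
  rewrite -(fineK (orlicz_fin_num (mulr_ge0 (ler0n _ 2) (u0 k)))) -EFinM sumEFin lee_fin.
  rewrite sumr_const card_ord -[leRHS]mulr_natl mulrCA ler_peMr//.
    by rewrite ltW// (lt_trans ltr01).
  by case: (umP k).
rewrite !big_nat; apply: lee_sum => j /bP bj.
apply: le_trans (orlicz_scale_ge _ (ltW c2e) _) _.
  by rewrite mulr_ge0.
apply: orlicz_mono.
  exact: mulr_ge0 (ltW (lt_trans ltr01 c2e)) (mulr_ge0 (ler0n _ 2) (u0 _)).
have := yP j bj; rewrite (ger0_norm (u0 _)) normrM normfV (gtr0_norm e0) => h.
rewrite ler_pdivlMr//; apply: le_trans h.
by rewrite le_eqVlt; apply/orP; left; apply/eqP; field; rewrite gt_eqF.
Qed.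

End not_delta2.

(** * Averages of Bochner integrable functions *)

Section average.
Context d (T : measurableType d) (R : realType) (V : normedModType R).
Context (mu : {finite_measure set T -> \bar R}).

(** The average of g over F stays in any closed ball that contains the values of g on F. For a
    simple approximation s_n this follows, up to a small error, from |s_n - v| <= |g - s_n| + e on
    F. *)
Lemma bochner_integral_dist (g : T -> V) (F : set T) (w v : V) (e : R) :
  measurable F -> strongly_measurable g -> is_bochner_integral mu F g w ->
  0 <= e -> (forall x, F x -> `|g x - v| <= e) ->
  `|w - fine (mu F) *: v| <= e * fine (mu F).
Proof.
move=> mF sg [s [ss sI] sw] e0 ge; apply/ler_addgt0Pr => r r0.
have r2 : 0 < r / 2 by rewrite divr_gt0.
have r2' : (0 < (r / 2)%:E)%E by rewrite lte_fin.
have /cvgrPdist_le/(_ _ r2) near1 := sw.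
have near2 := cvge_near_lt sI r2'.
have [n [/= dist_n int_n]] := filter_ex (filterI near1 near2).
have cs : is_simple (fun _ : T => v) := @simple_cst _ T _ v.
have scs : is_simple (fun x => s n x - v).
  exact: (simple_comp (fun p => p.1 - p.2) (simple_pair (ss n) cs)).
have mscs : measurable_fun setT (fun x => `|s n x - v|%:E).
  exact: (simple_measurable_fun (simple_comp (fun u => `|u|%:E) scs)).
have mgs : measurable_fun setT (fun x => `|g x - s n x|%:E).
  by apply/measurable_EFinP; exact: measurable_normB.
have mgv : measurable_fun setT (fun x => `|g x - v|%:E).
  by apply/measurable_EFinP; exact: measurable_normB.
have : (`|simple_integral mu F (s n) - fine (mu F) *: v|%:E <=
    (r / 2)%:E + (e * fine (mu F))%:E)%E.
  rewrite -simple_integral_cst// -simple_integralB//.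
  apply: le_trans (norm_simple_integral mu mF scs) _.
  apply: (@le_trans _ _ (\int[mu]_(x in F) (`|g x - s n x|%:E + e%:E))%E).
    apply: ge0_le_integral => //.
    - exact: measurable_funTS.
    - by apply: emeasurable_funD; [exact: measurable_funTS|exact: measurable_cst].
    - move=> x Fx; rewrite -EFinD lee_fin.
      rewrite (_ : s n x - v = (g x - v) - (g x - s n x)); last first.
        by rewrite opprB [RHS]addrC addrA subrK.
      rewrite [leRHS]addrC; apply: le_trans (ler_normB _ _) _.
      by rewrite lerD2r ge.
  rewrite ge0_integralD//; last exact: measurable_funTS.
  rewrite integral_cst// [X in (_ <= _ + X)%E]EFinM fineK ?fin_num_measure// leeD2r//.
  apply: le_trans (ltW int_n); exact: ge0_subset_integral.
rewrite -EFinD lee_fin => h.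
rewrite -(subrKA (simple_integral mu F (s n))).
apply: le_trans (ler_normD _ _) _; apply: le_trans (lerD dist_n h) _.
by rewrite [r in leRHS]splitr; lra.
Qed.

End average.

(** * The vector measure carried by the blocks *)

Section block_measure.
Context (R : realType) (phi : orlicz R) (x : nat -> R) (b : nat -> nat).
Hypothesis x1 : (modular phi x <= 1)%E.
Context d (T : measurableType d) (mu : {finite_measure set T -> \bar R}).
Variable I : nat -> set T.
Hypothesis mI : forall k, measurable (I k).

Let muI E k : R := fine (mu (E `&` I k)).

Let muI_ge0 E k : 0 <= muI E k. Proof. exact: fine_ge0. Qed.

Let muI_le E k : measurable E -> muI E k <= fine (mu E).
Proof.
move=> mE; have mEI : measurable (E `&` I k) by exact: measurableI.
apply: fine_le; rewrite ?fin_num_measure//; apply: le_measure => //; exact/mem_set.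
Qed.

(** The image of (mu(E [&] I_k))_k under the embedding of l^oo. [insubd] falls back on 0 outside the
    space; [GP] shows that this never happens for measurable E. *)
Definition block_measure (E : set T) : ell phi :=
  insubd (0 : ell phi) (fun j => muI E (b j) * x j).
Local Notation G := block_measure.

Let GP E : measurable E -> let y := fun j => muI E (b j) * x j in
  y \in ell_pred phi /\ luxemburg phi y <= fine (mu E).
Proof.
move=> mE; apply: (modular_luxemburg x1); first exact: fine_ge0.
by move=> j; rewrite normrM ger0_norm// ler_wpM2r// muI_le.
Qed.

Lemma block_measureE E j : measurable E -> G E j = muI E (b j) * x j.
Proof.
by move=> mE; rewrite -[LHS]/(val (G E) j) insubdK//; exact: (GP mE).1.
Qed.

(** Every coordinate is at most mu(E) |x_j|, and x has modular at most 1. Sigma-additivity, bounded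
    variation and absolute continuity all rest on this bound. *)
Lemma norm_block_measure E : measurable E -> `|G E| <= fine (mu E).
Proof.
move=> mE; apply: le_trans (GP mE).2; apply: luxemburg_mono (GP mE).1 => j.
by rewrite block_measureE.
Qed.

Lemma block_measureU A B : measurable A -> measurable B -> A `&` B = set0 ->
  G (A `|` B) = G A + G B.
Proof.
move=> mA mB AB; apply/val_inj/funext => j.
rewrite [LHS]block_measureE; last exact: measurableU.
rewrite -[RHS]/(G A j + G B j) !block_measureE// -mulrDl; congr (_ * _).
rewrite /muI setIUl measureU ?fineD ?fin_num_measure//; try exact: measurableI.
by rewrite setIACA AB set0I.
Qed.

(** Finite additivity reduces the claim to the remainder U [\] Un, whose image has norm at most its
    measure, which tends to 0. *)
Lemma block_measure_vector_measure : vector_measure G.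
Proof.
move=> F mF tF; set U := \bigcup_i F i.
have mU : measurable U by exact: bigcupT_measurable.
pose Un n := \big[setU/set0]_(i < n) F i.
have mUn n : measurable (Un n) by exact: bigsetU_measurable.
have GUn n : G (Un n) = \sum_(0 <= i < n) G (F i).
  elim: n => [|n ih]; last first.
    rewrite big_nat_recr//= -ih /Un big_ord_recr/= block_measureU//; first exact: mUn.
    apply/seteqP; split => // t; rewrite -bigcup_mkord => -[[i /= ltin Fit] Fnt].
    have in_ : i = n by apply: tF => //; exists t.
    by rewrite in_ ltnn in ltin.
  rewrite /Un big_ord0 big_geq//; apply/normr0_eq0/le_anti.
  rewrite normr_ge0 andbT; apply: le_trans (norm_block_measure measurable0) _.
  by rewrite measure0.
have UnU n : Un n `<=` U by exact: bigsetU_bigcup.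
have muU : fine (mu (Un n)) @[n --> \oo] --> fine (mu U).
  apply: fine_cvg; rewrite fineK ?fin_num_measure//.
  rewrite (_ : (fun n => mu (Un n)) = fun n => \sum_(0 <= i < n) mu (F i))%E.
    exact: measure_semi_sigma_additive.
  by apply/funext => n; rewrite measure_bigsetU// big_mkord.
apply/cvgrPdist_le => e e0; have /cvgrPdist_le/(_ _ e0) := muU.
apply: filterS => n h; rewrite -GUn.
have -> : U = Un n `|` (U `\` Un n) by rewrite setDUK.
have mD : measurable (U `\` Un n) by exact: measurableD.
rewrite block_measureU//; last by rewrite setDIK.
rewrite addrAC subrr add0r; apply: le_trans (norm_block_measure mD) _.
apply: le_trans h; rewrite measureD// ?ltey_eq ?fin_num_measure//.
rewrite (setIidr (UnU n)) fineB ?fin_num_measure//.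
exact: ler_norm.
Qed.

Lemma block_measure_variation : (vector_variation G setT < +oo)%E.
Proof.
apply: (@le_lt_trans _ _ (mu setT)); last by rewrite ltey_eq fin_num_measure.
apply: ge_ereal_sup => _ [n [F [mF tF FT ->]]].
have mU : measurable (\big[setU/set0]_(i < n) F i).
  by apply: bigsetU_measurable => i _; exact: mF.
rewrite -FT bigcup_mkord measure_semi_additive_ord_I// -sumEFin.
apply: lee_sum => i _; have mFi := mF i (ltn_ord i).
by have := norm_block_measure mFi; rewrite -lee_fin fineK ?fin_num_measure.
Qed.

Lemma block_measure_mu_continuous : mu_continuous mu G.
Proof.
move=> e e0; exists e => // E mE muE; apply: le_lt_trans (norm_block_measure mE) _.
by rewrite -lte_fin fineK// fin_num_measure.
Qed.

Hypothesis xb : forall (y : ell phi) k c, 0 <= c ->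
  (forall j, b j = k -> c * `|x j| <= `|y j|) -> c / 2 <= `|y|.
Hypothesis I_split : forall E, measurable E -> (0 < mu E)%E ->
  exists k, (0 < mu (E `&` I k))%E /\ (0 < mu (E `\` I k))%E.
Hypothesis mu_gt0 : (0 < mu setT)%E.

(* On a set of positive measure where the density would be within 1/8 of a vector
   v, the averages of G over all subsets of positive measure are within 1/8 of v;
   but those over the two parts cut out by some I k are at distance at least
   1/2. *)
Lemma block_measure_no_density (g : T -> ell phi) : strongly_measurable g ->
  ~ (forall E, measurable E -> is_bochner_integral mu E g (G E)).
Proof.
move=> sg gG; have [s ss sgx] := sg.
have e0 : 0 < 8^-1 :> R by rewrite invr_gt0.
pose A n := [set t | `|g t - s n t| < 8^-1].
have mA n : measurable (A n).
  rewrite /A -[X in measurable X]setTI.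
  have mgs := measurable_normB sg (ss n).
  exact: (measurable_fun_ltr mgs (measurable_cst _)).
(* The sets A_n cover T by pointwise convergence, so they cannot all be null. *)
have [n An] : exists n, (0 < mu (A n))%E.
  apply: contrapT => h.
  have : mu.-negligible (\bigcup_n A n).
    apply: negligible_bigcup => n; apply/negligibleP => //.
    apply/eqP; rewrite eq_le measure_ge0 andbT leNgt; apply/negP => h'.
    by apply: h; exists n.
  rewrite (_ : \bigcup_n A n = setT); last first.
    apply/seteqP; split => // t _; have /cvgrPdist_lt/(_ _ e0)[n _ hn] := sgx t.
    by exists n => //; exact: (hn n (leqnn n)).
  by move/negligibleP => /(_ measurableT) mu0; move: mu_gt0; rewrite mu0 ltxx.
(* A_n splits into finitely many level sets of s_n; on one of positive measure g is within 1/8 of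
   the constant v. *)
have [v Ev] : exists v, (0 < mu (A n `&` s n @^-1` [set v]))%E.
  apply: contrapT => h.
  have := integral_simple mu (fun=> 1 : R) (mA n) (ss n).
  rewrite (integral_cst _ (mA n) 1%E) mul1e fsbig1 => [mu0|v _].
    by rewrite mu0 ltxx in An.
  rewrite mulr1; suff -> : mu (A n `&` s n @^-1` [set v]) = 0%E by [].
  apply/eqP; rewrite eq_le measure_ge0 andbT leNgt; apply/negP => h'.
  by apply: h; exists v.
set E := A n `&` _ in Ev.
have mE : measurable E by apply: measurableI => //; exact: (ss n).2.
have [k [E1 E2]] := I_split mE Ev.
have av F : measurable F -> F `<=` E ->
    `|G F - fine (mu F) *: v| <= 8^-1 * fine (mu F).
  move=> mF FE; apply: (bochner_integral_dist mF sg (gG _ mF) (ltW e0)).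
  by move=> t /FE[/ltW + /= <-].
set F1 := E `&` I k in E1; set F2 := E `\` I k in E2.
have mF1 : measurable F1 by exact: measurableI.
have mF2 : measurable F2 by exact: measurableD.
have a1 := av _ mF1 (@subIsetl _ _ _); have a2 := av _ mF2 (@subDsetl _ _ _).
have m1 : 0 < fine (mu F1) by rewrite fine_gt0// E1 ltey_eq fin_num_measure.
have m2 : 0 < fine (mu F2) by rewrite fine_gt0// E2 ltey_eq fin_num_measure.
set p := fine (mu F1) in a1 m1; set q := fine (mu F2) in a2 m2.
(* This is the distance between the averages over F1 and F2, multiplied by pq. On block k, G(F1) has
   entries p x_j since F1 lies in I_k, and G(F2) vanishes since F2 misses I_k. *)
have : p * q / 2 <= `|q *: G F1 - p *: G F2|.
  apply: (xb (k := k)); first by rewrite mulr_ge0// ltW.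
  move=> j bj; rewrite ell_subE !ell_scaleE !block_measureE// /muI bj.
  have -> : F2 `&` I k = set0 by apply/seteqP; split => // t [[_ +] /=].
  rewrite (_ : F1 `&` I k = F1); last by rewrite /F1 -setIA setIid.
  rewrite -/p measure0 mul0r mulr0 subr0 !normrM (gtr0_norm m1) (gtr0_norm m2).
  by rewrite mulrA [q * p]mulrC.
rewrite leNgt => /negP; apply.
(* Passing through v bounds the same norm by pq/8 + pq/8 = pq/4, below pq/2. *)
have -> : q *: G F1 - p *: G F2 = q *: (G F1 - p *: v) - p *: (G F2 - q *: v).
  by rewrite !scalerBr !scalerA [p * q]mulrC opprB addrA subrK.
apply: le_lt_trans (ler_normB _ _) _.
rewrite !normrZ (gtr0_norm m1) (gtr0_norm m2).
have pq : 0 < p * q by rewrite mulr_gt0.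
have h1 := ler_wpM2l (ltW m2) a1; have h2 := ler_wpM2l (ltW m1) a2.
apply: le_lt_trans (lerD h1 h2) _; rewrite -subr_gt0.
have -> : p * q / 2 - (q * (8^-1 * p) + p * (8^-1 * q)) = p * q / 4 by field.
by rewrite divr_gt0.
Qed.

End block_measure.

(** * Lebesgue measure on the unit interval and rational rays *)

Section unit_interval.
Context (R : realType).

Definition unit_itv : set (measurableTypeR R) := `[0 : R, 1]%classic.

Lemma measurable_unit_itv : measurable unit_itv. Proof. exact: measurable_itv. Qed.

Lemma unit_itv_fin : (lebesgue_measure unit_itv < +oo)%E.
Proof. by rewrite /unit_itv lebesgue_measure_itv/= lte_fin ltr01 ltry. Qed.

Definition unit_measure : {finite_measure set (measurableTypeR R) -> \bar R} :=
  mfrestr measurable_unit_itv unit_itv_fin.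
Local Notation mu := unit_measure.

Lemma unit_measureE E : mu E = lebesgue_measure (E `&` unit_itv).
Proof. by []. Qed.

(* k codes a pair (i, n), the ray ending at i / n (at 0 when n = 0). *)
Definition rat_ray (k : nat) : set (measurableTypeR R) :=
  let q := CodeSeq.decode k in
  `]-oo, ((nth 0%N q 0)%:R / (nth 0%N q 1)%:R : R)]%classic.

Lemma measurable_rat_ray k : measurable (rat_ray k).
Proof. exact: measurable_itv. Qed.

Lemma rat_rayE i n :
  rat_ray (CodeSeq.code [:: i; n]) = `]-oo, (i%:R / n%:R : R)]%classic.
Proof. by rewrite /rat_ray CodeSeq.codeK. Qed.

Lemma unit_measureT_gt0 : (0 < mu setT)%E.
Proof.
by rewrite !unit_measureE setTI /unit_itv lebesgue_measure_itv/= lte_fin ltr01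
  sube0 lte_fin.
Qed.

(** If no ray splits E, each mu(E [&] ]-oo, i/N]) is 0 or mu(E). A step from i to i + 1 adds at most
    1/N < mu(E), so starting from 0 the value remains 0 up to i = N, where it should be mu(E). *)
Lemma rat_ray_split E : measurable E -> (0 < mu E)%E ->
  exists k, (0 < mu (E `&` rat_ray k))%E /\ (0 < mu (E `\` rat_ray k))%E.
Proof.
move=> mE muE; have fE : mu E \is a fin_num by exact: fin_num_measure.
have a0 : 0 < fine (mu E) by rewrite fine_gt0// muE ltey_eq fE.
pose N := (Num.truncn (fine (mu E))^-1).+1.
have N0 : 0 < N%:R :> R by rewrite ltr0n.
have Na : N%:R^-1 < fine (mu E).
  by rewrite invf_plt ?posrE// truncnS_gt.
pose J i : set (measurableTypeR R) := `]-oo, (i%:R / N%:R)]%classic.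
have mJ i : measurable (J i) by exact: measurable_itv.
pose D i : set (measurableTypeR R) := `](i%:R / N%:R), (i.+1%:R / N%:R)]%classic.
have mD i : measurable (D i) by exact: measurable_itv.
have mEJ i : measurable (E `&` J i) by exact: measurableI.
apply: contrapT => h.
have nosplit i : (mu (E `&` J i) < mu E)%E -> mu (E `&` J i) = 0%E.
  move=> lt; apply/eqP; rewrite eq_le measure_ge0 andbT leNgt; apply/negP => gt0.
  apply: h; exists (CodeSeq.code [:: i; N]); rewrite rat_rayE; split => //.
  by rewrite measureD ?ltey_eq ?fE// sube_gt0.
have all0 i : mu (E `&` J i) = 0%E.
  elim: i => [|i ih].
    (* For i = 0 the ray meets the unit interval only in the point 0. *)
    apply/eqP; rewrite eq_le measure_ge0 andbT.
    have <- : lebesgue_measure (`[0 : R, 0]%classic : set (measurableTypeR R)) = 0%E.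
      by rewrite lebesgue_measure_itv/= lte_fin ltxx.
    rewrite unit_measureE; apply: le_measure; [|by apply/mem_set; exact: measurable_itv|].
      by apply/mem_set/measurableI => //; exact: measurable_unit_itv.
    move=> t [[_]]; rewrite /J /unit_itv /= !in_itv/= mul0r => t0 /andP[t0' _].
    by rewrite t0 t0'.
  apply: nosplit; apply: le_lt_trans (_ : N%:R^-1%:E < mu E)%E; last first.
    by rewrite -(fineK fE) lte_fin.
  apply: (@le_trans _ _ (mu (E `&` J i) +
      lebesgue_measure (D i))%E).
    rewrite !unit_measureE.
    have mI : measurable (E `&` J i `&` unit_itv).
      by apply: measurableI => //; exact: measurable_unit_itv.
    apply: le_trans (measureU2 _ mI (mD i)).
    apply: le_measure.
    - by apply/mem_set/measurableI => //; exact: measurable_unit_itv.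
    - exact/mem_set/measurableU.
    - move=> t [[Et]]; rewrite /J /D /= !in_itv/= => ti ut.
      have [tle|tgt] := leP t (i%:R / N%:R); first by left.
      by right.
  rewrite ih add0e /D lebesgue_measure_itv/= lte_fin.
  case: ifP => _; last by rewrite lee_fin invr_ge0 ltW.
  by rewrite -EFinB lee_fin -mulrBl -natrB// subSnn mul1r.
have := all0 N; rewrite (_ : mu (E `&` J N) = mu E).
  by move=> mu0; rewrite mu0 ltxx in muE.
rewrite !unit_measureE; congr lebesgue_measure.
apply/seteqP; split => [t [[]]//|t [Et ut]]; split => //; split => //.
move: ut; rewrite /J /unit_itv /= !in_itv/= divff ?gt_eqF//.
by case/andP.
Qed.

End unit_interval.

Lemma RNP_Delta2 (R : realType) (phi : orlicz R) : finite_orlicz phi ->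
  radon_nikodym_property (ell phi) -> Delta2_0 phi.
Proof.
move=> phi_finite rnp; apply: contrapT => ND2.
have [x [b [x1 xb]]] := not_Delta2_blocks phi_finite ND2.
pose mI := @measurable_rat_ray R.
pose G := block_measure phi x b (@unit_measure R) (@rat_ray R).
have [g [sg _] gG] : exists2 g, bochner_integrable (@unit_measure R) g &
    forall E, measurable E -> is_bochner_integral (@unit_measure R) E g (G E).
  apply: rnp.
  - exact: block_measure_vector_measure.
  - exact: block_measure_variation.
  - exact: block_measure_mu_continuous.
apply: (block_measure_no_density x1 mI xb _ _ sg gG).
- exact: rat_ray_split.
- exact: unit_measureT_gt0.
Qed.

Theorem theorem3p6 (R : realType) (phi : orlicz R) (phi_finite : finite_orlicz phi) :
  radon_nikodym_property (ell phi) <-> Delta2_0 phi.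
Proof. by split; [exact: RNP_Delta2|exact: Delta2_RNP]. Qed.
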